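(* Let $\mathbf{x}_1,\dots,\mathbf{x}_N\in\mathbb{R}^K$, let $\alpha,\alpha_1,\dots,\alpha_L\in\mathbb{R}$, let $\mathbf{A}_1,\dots,\mathbf{A}_L$ be nonzero real matrices with $K$ rows, and let $\rho$ and $h_1,\dots,h_L$ be continuous real-valued functions on $(0,\infty)$. Define, for $\boldsymbol{\Sigma}\in\mathbb{S}_{++}^K$, $$\tilde L(\boldsymbol{\Sigma})=\frac N2\log\det(\boldsymbol{\Sigma})+\sum_{i=1}^N\rho\left(\mathbf{x}_i^T\boldsymbol{\Sigma}^{-1}\mathbf{x}_i\right)+\alpha\log\det(\boldsymbol{\Sigma})+\sum_{l=1}^L\alpha_l h_l\left(\mathrm{Tr}\left(\mathbf{A}_l^T\boldsymbol{\Sigma}^{-1}\mathbf{A}_l\right)\right).$$ Let $a_\rho,a_\rho'$ be the quantities $a_f,a_f'$ (defined in the context) for $f=\rho$, and let $a_l,a_l'$ be those for $f=\alpha_l h_l$; assume $a_\rho\ge 0$ and $a_l\ge 0$ for all $l$. Suppose that: (i) $\mathbf{x}_i\ne\mathbf{0}$ for every $i$; (ii) for every proper subspace $S$ of $\mathbb{R}^K$, $$P_N(S)<\min\left\{1-\frac{(N+2\alpha)(K-\dim S)-\sum_{l\in\upsilon}a_l}{a_\rho N},\ \frac{(N+2\alpha)\dim S-\sum_{l\in\omega}a_l'}{a_\rho' N}\right\},$$ where $\omega=\{l:\mathrm{range}(\mathbf{A}_l)\subseteq S\}$ and $\upsilon=\{l:\mathrm{range}(\mathbf{A}_l)\not\subseteq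 S\}$ (all the quotients being well defined); (iii) $\left(-\frac N2-\alpha\right)K+\frac{a_\rho'}{2}N+\frac12\sum_{l}a_l'<0$ and $\frac{a_\rho}{2}N-\left(\frac N2+\alpha\right)K+\frac12\sum_l a_l>0$. Then $\tilde L(\boldsymbol{\Sigma})\to+\infty$ on the boundary of $\mathbb{S}_{++}^K$; that is, $\tilde L(\boldsymbol{\Sigma}^k)\to+\infty$ for every sequence $\boldsymbol{\Sigma}^k\in\mathbb{S}_{++}^K$ with $\lambda_{\max}(\boldsymbol{\Sigma}^k)\to+\infty$ or $\lambda_{\min}(\boldsymbol{\Sigma}^k)\to0$.
   Context: $\mathbb{S}_{++}^K$ is the set of real symmetric positive definite $K\times K$ matrices; $\lambda_{\max},\lambda_{\min}$ denote largest and smallest eigenvalues. $P_N(S)=\frac1N\sum_{i=1}^N 1_{\{\mathbf{x}_i\in S\}}$ is the proportion of samples in $S$. ''Proper subspace'' means a linear subspace $S$ with $1\le\dim S\le K-1$. By convention a sequence of matrices in $\mathbb{S}_{++}^K$ converges to the boundary of $\mathbb{S}_{++}^K$ iff $\lambda_{\max}\to+\infty$ or $\lambda_{\min}\to 0$. For a continuous function $f$ on $(0,\infty)$ define, as extended real numbers, $$a_f=\sup\{a: s^{a/2}\exp(-f(s))\to0\text{ as }s\to+\infty\},\qquad a_f'=\inf\{a: s^{a/2}\exp(-f(s))\to0\text{ as }s\to0\}.$$ For example, for $c>0$: $f(s)=c\log s$ gives $a_f=a_f'=2c$, and $f(s)=cs$ gives $a_f=+\infty$, $a_f'=0$. Attention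 is restricted to functions with $a_f\ge0$.
   Formalization: In (ii) the denominator a'_ρN is required to be nonnegative (so a'_ρ ≥ 0 when K ≥ 2), since for a'_ρ < 0 the stated inequality has the wrong direction and the claim fails; quotients c/0 with c ≠ 0 are read as ±∞. *)

(* Defs.v *)
From HB Require Import structures.
From mathcomp Require Import all_boot all_order all_algebra.
From mathcomp Require Import all_classical all_reals all_analysis.
Set Implicit Arguments.
Unset Strict Implicit.
Unset Printing Implicit Defensive.
Import Order.TTheory GRing.Theory Num.Theory.
Import numFieldNormedType.Exports.
Local Open Scope classical_set_scope.
Local Open Scope ring_scope.

Section Defs.
Variable R : realType.

Definition posdefmx (K : nat) (Sigma : 'M[R]_K) : Prop :=
  Sigma \is symmetricmx /\
  forall v : 'cV[R]_K, v != 0 -> 0 < (v^T *m Sigma *m v) ord0 ord0.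

(* The spectrum of a symmetric matrix is finite, and nonempty when 0 < K, so
   that sup and inf are then a maximum and a minimum. *)
Definition lambda_max (K : nat) (Sigma : 'M[R]_K) : R :=
  sup [set a | eigenvalue Sigma a].
Definition lambda_min (K : nat) (Sigma : 'M[R]_K) : R :=
  inf [set a | eigenvalue Sigma a].

Definition mxrange (m n : nat) (A : 'M[R]_(m, n)) : {vspace 'cV[R]_m} :=
  limg (linfun (mulmx A : 'cV[R]_n -> 'cV[R]_m)).

Definition proper_subspace (K : nat) (S : {vspace 'cV[R]_K}) : bool :=
  (1 <= \dim S <= K.-1)%N.

Definition sample_prop (K N : nat) (x : 'I_N -> 'cV[R]_K)
    (S : {vspace 'cV[R]_K}) : R :=
  N%:R^-1 * \sum_(i < N) (x i \in S)%:R.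

(* A function on (0, +oo) is represented by a total function on R of which
   only the values at positive arguments are ever used. *)
Definition tail_exponent (f : R -> R) : \bar R :=
  ereal_sup [set a%:E | a in
    [set a : R | s `^ (a / 2) * expR (- f s) @[s --> +oo%R] --> (0 : R)]].
Definition origin_exponent (f : R -> R) : \bar R :=
  ereal_inf [set a%:E | a in
    [set a : R | s `^ (a / 2) * expR (- f s) @[s --> 0^'+] --> (0 : R)]].

(* The extended-real sum of the [F i] never meets +oo together with -oo. *)
Definition sume_def (I : finType) (F : I -> \bar R) : Prop :=
  forall i j, (F i +? F j)%E.

(* [p / q] is meaningful as an extended real for a nonnegative denominator:
   0 / 0 and oo / oo are excluded (as 0^-1 = +oo and +oo^-1 = 0, these are the
   forms 0 * oo and oo * 0), and c / 0 is +oo for 0 < c and -oo for c < 0. *)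
Definition dive_def (p q : \bar R) : bool :=
  ((0 <= q) && (p *? q^-1))%E.

Definition Ltilde (K N L : nat) (x : 'I_N -> 'cV[R]_K)
    (p : 'I_L -> nat) (A : forall l, 'M[R]_(K, p l))
    (alpha : R) (alphas : 'I_L -> R) (rho : R -> R) (h : 'I_L -> R -> R)
    (Sigma : 'M[R]_K) : R :=
  N%:R / 2 * ln (\det Sigma)
  + \sum_(i < N) rho (((x i)^T *m invmx Sigma *m x i) ord0 ord0)
  + alpha * ln (\det Sigma)
  + \sum_(l < L) alphas l * h l (\tr ((A l)^T *m invmx Sigma *m A l)).

End Defs.

(* Main.v *)
(* Treat the vectors [x i] and the matrices [A l] uniformly as matrices [M j]
   with functions [f j], and let [q] be the quadratic form of [Sigma^-1]. From
   the columns of the [M j] and the standard basis choose greedily a basis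
   [b_0, ..., b_(K-1)] with [q] minimal at each step, and put [w_i = ln q(b_i)].
   If [m] is the last index for which the range of [M j] is not contained in
   [V_m = <b_0, ..., b_(m-1)>], then [ln tr (M_j^T Sigma^-1 M_j)] is [w_m] up to
   an error depending only on the basis, hence bounded because there are
   finitely many bases. Moreover [D = ln det Sigma + sum_i w_i] is bounded below
   (Hadamard). Since [w] is nondecreasing, Abel summation expresses the
   objective through the quantities in (ii) and (iii) for the subspaces [V_m],
   which are positive. Hence the objective is at least
   [c (D + max (w_(K-1)) 0 + max (- w_0) 0) - C], and this dominates [|ln a|] for
   every eigenvalue [a] of [Sigma]. *)
Require Import Defs.
From HB Require Import structures.
From mathcomp Require Import all_boot all_order all_algebra.
From mathcomp Require Import all_classical all_reals all_analysis.
From mathcomp Require Import perm ring lra zify complex.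
Set Implicit Arguments.
Unset Strict Implicit.
Unset Printing Implicit Defensive.
Import Order.TTheory GRing.Theory Num.Theory.
Import numFieldNormedType.Exports.
Local Open Scope classical_set_scope.
Local Open Scope ring_scope.

(** * Positive definite matrices *)

Lemma rV_neq0_entry {V : zmodType} n (v : 'rV[V]_n) : v != 0 ->
  exists i, v ord0 i != 0.
Proof.
move=> v0; apply/existsP; apply: contra_neqT v0 => /existsPn v0.
by apply/rowP => i; rewrite mxE; apply/eqP; move: (v0 i); rewrite negbK.
Qed.

Section PosDef.
Context {R : realType} {K : nat}.
Implicit Types (Q : 'M[R]_K) (x y : 'cV[R]_K).

Definition bform Q x y : R := (x^T *m Q *m y) ord0 ord0.
Definition qform Q x : R := bform Q x x.

Lemma posdef_sym Q : posdefmx Q -> Q^T = Q.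
Proof.
move=> [/is_hermitianmxP QE _]; apply/esym; rewrite {1}QE expr0 scale1r.
by apply/matrixP => i j; rewrite !mxE.
Qed.

Lemma bformC Q x y : posdefmx Q -> bform Q x y = bform Q y x.
Proof.
move=> Qpd; rewrite /bform.
have -> : y^T *m Q *m x = (x^T *m Q *m y)^T.
  by rewrite !trmx_mul trmxK (posdef_sym Qpd) mulmxA.
by rewrite [RHS]mxE.
Qed.

Lemma bformDr Q x y z : bform Q x (y + z) = bform Q x y + bform Q x z.
Proof. by rewrite /bform mulmxDr mxE. Qed.

Lemma bformZr Q a x y : bform Q x (a *: y) = a * bform Q x y.
Proof. by rewrite /bform -scalemxAr mxE. Qed.

Lemma bformDl Q x y z : bform Q (y + z) x = bform Q y x + bform Q z x.
Proof. by rewrite /bform linearD /= !mulmxDl mxE. Qed.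

Lemma bformZl Q a x y : bform Q (a *: y) x = a * bform Q y x.
Proof. by rewrite /bform linearZ /= -!scalemxAl mxE. Qed.

Lemma qform_gt0 Q x : posdefmx Q -> x != 0 -> 0 < qform Q x.
Proof. by move=> [_]; exact. Qed.

Lemma qform_ge0 Q x : posdefmx Q -> 0 <= qform Q x.
Proof.
move=> Qpd; have [->|x0] := eqVneq x 0; last exact/ltW/qform_gt0.
by rewrite /qform /bform mulmx0 mxE.
Qed.

Lemma qformD Q x y : posdefmx Q ->
  qform Q (x + y) = qform Q x + 2 * bform Q x y + qform Q y.
Proof.
move=> Qpd; rewrite /qform !(bformDr, bformDl) (bformC y x Qpd); ring.
Qed.

Lemma qformZ Q a x : qform Q (a *: x) = a ^+ 2 * qform Q x.
Proof. by rewrite /qform bformZr bformZl mulrA expr2. Qed.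

Lemma qformD_le Q x y : posdefmx Q ->
  qform Q (x + y) <= 2 * qform Q x + 2 * qform Q y.
Proof.
move=> Qpd; have := qform_ge0 (x + (-1) *: y) Qpd.
rewrite !qformD // qformZ bformZr; lra.
Qed.

(** The form is evaluated at [q(y) x - b(x, y) y], a multiple of the component of [x] orthogonal to
    [y]; its value there is [q(y)] times the desired difference. *)
Lemma bform_CauchySchwarz Q x y : posdefmx Q ->
  bform Q x y ^+ 2 <= qform Q x * qform Q y.
Proof.
move=> Qpd; have [->|y0] := eqVneq y 0.
  by rewrite /qform /bform !mulmx0 mxE expr0n mulr0.
have qy := qform_gt0 Qpd y0.
have := qform_ge0 (qform Q y *: x + (- bform Q x y) *: y) Qpd.
rewrite qformD // !qformZ bformZl bformZr => H.
suff : 0 <= qform Q y * (qform Q x * qform Q y - bform Q x y ^+ 2).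
  by rewrite pmulr_rge0 // subr_ge0.
by apply: le_trans H _; rewrite le_eqVlt; apply/orP; left; apply/eqP; ring.
Qed.

Lemma normr_bform_le Q x y : posdefmx Q ->
  `|bform Q x y| <= Num.sqrt (qform Q x) * Num.sqrt (qform Q y).
Proof.
move=> Qpd; rewrite -sqrtrM ?qform_ge0 // -sqrtr_sqr ler_wsqrtr //.
exact: bform_CauchySchwarz.
Qed.

Lemma bform_delta Q i j :
  bform Q (delta_mx i ord0) (delta_mx j ord0) = Q i j.
Proof.
by rewrite /bform trmx_delta -rowE -colE !mxE.
Qed.

(** Entries are values of the bilinear form on standard basis vectors, so by Cauchy-Schwarz the
    diagonal controls all of them. *)
Lemma posdef_entry_le Q c i j : posdefmx Q ->
  (forall k, qform Q (delta_mx k ord0) <= c) -> `|Q i j| <= c.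
Proof.
move=> Qpd qc; rewrite -bform_delta.
apply: le_trans (normr_bform_le _ _ Qpd) _.
have c0 : 0 <= c by apply: le_trans (qc i); exact: qform_ge0.
by rewrite -[leRHS]sqr_sqrtr // expr2 ler_pM ?sqrtr_ge0 ?ler_wsqrtr.
Qed.

Lemma posdef_unitmx Q : posdefmx Q -> Q \in unitmx.
Proof.
move=> Qpd; rewrite unitmxE unitfE; apply/det0P => -[v v0 vQ].
have vT0 : v^T != 0 by rewrite -trmx0 (inj_eq trmx_inj).
have := qform_gt0 Qpd vT0.
by rewrite /qform /bform trmxK vQ mul0mx mxE ltxx.
Qed.

Lemma symmetricmxE Q : (Q \is symmetricmx) = (Q^T == Q).
Proof.
rewrite is_hermitianmxE expr0 scale1r eq_sym; congr (_ == _).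
by apply/matrixP => i j; rewrite !mxE.
Qed.

Lemma posdef_invmx Q : posdefmx Q -> posdefmx (invmx Q).
Proof.
move=> Qpd; have Qu := posdef_unitmx Qpd; split.
  by rewrite symmetricmxE trmx_inv (posdef_sym Qpd).
(* Writing [v = Q u] turns the form of [invmx Q] at [v] into the form of [Q] at [u]. *)
move=> v v0; set u := invmx Q *m v.
have vE : v = Q *m u by rewrite mulKVmx.
have u0 : u != 0 by apply: contra_neq v0; rewrite vE => ->; rewrite mulmx0.
suff -> : v^T *m invmx Q *m v = u^T *m Q *m u by exact: qform_gt0.
by rewrite -!mulmxA -/u vE trmx_mul (posdef_sym Qpd) !mulmxA.
Qed.

Lemma posdef_det_gt0 Q : posdefmx Q -> 0 < \det Q.
Proof.
(* [det (t Q + (1 - t) 1)] has no root for [t] in [0, 1]. *)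
move=> Qpd; pose F := 'X%:M *m map_mx polyC Q + (1 - 'X)%:M : 'M[{poly R}]_K.
have FE t : (\det F).[t] = \det (t *: Q + (1 - t)%:M).
  rewrite -horner_evalE -det_map_mx; congr (\det _).
  apply/matrixP => i j.
  rewrite /F mul_scalar_mx !mxE /= horner_evalE !hornerE.
  by case: (i == j); rewrite /= ?mulr1n ?mulr0n !hornerE.
have F0 : (\det F).[0] = 1 by rewrite FE scale0r add0r subr0 det1.
have F1 : (\det F).[1] = \det Q.
  by rewrite FE scale1r subrr raddf0 addr0.
rewrite ltNge; apply/negP => detQ.
(* [poly_ivt] wants a passage from nonpositive to nonnegative, hence the opposite polynomial: it is
   [-1] at [0] and [- \det Q] at [1]. *)
have : (- \det F).[0] <= 0 <= (- \det F).[1].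
  by rewrite !hornerE F0 F1 oppr_ge0 detQ andbT lerN10.
case/(poly_ivt ler01) => t /andP[t0 t1].
rewrite rootN /root FE => /det0P[v v0 vF].
have vT0 : v^T != 0 by rewrite -trmx0 (inj_eq trmx_inj).
have : t * qform Q v^T + (1 - t) * (v *m v^T) ord0 ord0 = 0.
  move/(congr1 (fun A => (A *m v^T) ord0 ord0)): vF.
  rewrite mul0mx mulmxDr mulmxDl -scalemxAr mul_mx_scalar -!scalemxAl.
  by rewrite /qform /bform trmxK !mxE.
have q0 := qform_gt0 Qpd vT0.
have n0 : 0 < (v *m v^T) ord0 ord0.
  have [i vi] := rV_neq0_entry v0.
  rewrite mxE (bigD1 i) //= mxE ltr_pwDl // -?expr2 ?exprn_even_gt0 //.
  by apply: sumr_ge0 => j _; rewrite mxE -expr2 sqr_ge0.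
(* Both forms are positive at the null vector, and one of the weights [t], [1 - t] is at least
   [1/2], so the combination cannot vanish. *)
case/orP: (le_total t (2^-1)) => ht; nra.
Qed.

(** Each of the [n!] products in the Leibniz formula has the same bound, because a permutation only
    reorders the factors [u]. It serves both for Gram matrices and for cofactors. *)
Lemma normr_det_le n (A : 'M[R]_n) (s u : 'I_n -> R) :
  (forall i j, `|A i j| <= s i * u j) -> (forall i, 0 <= s i) ->
  `|\det A| <= n`!%:R * ((\prod_i s i) * (\prod_i u i)).
Proof.
move=> As s0; rewrite /determinant.
apply: le_trans (ler_norm_sum _ _ _) _.
have -> : n`!%:R * ((\prod_i s i) * (\prod_i u i))
  = \sum_(t : 'S_n) ((\prod_i s i) * (\prod_i u i)).
  by rewrite sumr_const card_Sn mulr_natl.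
apply: ler_sum => t _; rewrite normrM normrX normrN1 expr1n mul1r normr_prod.
rewrite [X in _ * X](reindex_inj (@perm_inj _ t)) /= -big_split /=.
by apply: ler_prod => i _; rewrite normr_ge0 As.
Qed.

(* A weak form of Hadamard's inequality: Cauchy-Schwarz for the entries of the
   Gram matrix in the Leibniz formula. *)
Lemma posdef_det_le Q (B : 'M[R]_K) : posdefmx Q ->
  \det Q * \det B ^+ 2 <= K`!%:R * \prod_i qform Q (col i B).
Proof.
move=> Qpd; have -> : \det Q * \det B ^+ 2 = \det (B^T *m Q *m B).
  by rewrite !det_mulmx det_tr; ring.
apply: le_trans (ler_norm _) _.
have -> : \prod_i qform Q (col i B) =
  \prod_i Num.sqrt (qform Q (col i B)) * \prod_i Num.sqrt (qform Q (col i B)).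
  by rewrite -big_split; apply: eq_bigr => i _;
    rewrite /= -expr2 sqr_sqrtr ?qform_ge0.
apply: normr_det_le => [i j|i]; last exact: sqrtr_ge0.
have -> : (B^T *m Q *m B) i j = bform Q (col i B) (col j B).
  rewrite /bform tr_col -row_mul [LHS]mxE [RHS]mxE.
  by apply: eq_bigr => k _; rewrite !mxE.
exact: normr_bform_le.
Qed.

(** The constant is fixed before [Q]: it comes only from the coefficients of [x] on [X], through
    [q(y + z) <= 2 q(y) + 2 q(z)]. All later uniformity in [Sigma] rests on this. *)
Lemma qform_span_le (X : seq 'cV[R]_K) x : x \in <<X>>%VS ->
  exists2 C, 0 < C & forall Q t, posdefmx Q -> 0 <= t ->
    (forall y, y \in X -> qform Q y <= t) -> qform Q x <= C * t.
Proof.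
elim: X x => [|y X IH] x.
  rewrite span_nil memv0 => /eqP->; exists 1 => // Q t _ t0 _.
  by rewrite /qform /bform mulmx0 mxE mul1r.
rewrite span_cons => /memv_addP[_ /vlineP[c ->] [z /IH[C C0 hC] ->]].
exists (2 * c ^+ 2 + 2 * C) => [|Q t Qpd t0 ht].
  by have := sqr_ge0 c; lra.
apply: le_trans (qformD_le _ _ Qpd) _; rewrite qformZ.
have h1 : qform Q y <= t by apply: ht; rewrite mem_head.
have h2 : qform Q z <= C * t.
  by apply: hC => // w ws; apply: ht; rewrite in_cons ws orbT.
have := ler_wpM2l (sqr_ge0 c) h1; lra.
Qed.

(** The eigenvector equation is read at the coordinate of largest modulus. *)
Lemma eigenvalue_le (A : 'M[R]_K) c a : (forall i j, `|A i j| <= c) ->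
  eigenvalue A a -> `|a| <= K%:R * c.
Proof.
move=> Ac /eigenvalueP[v vA v0].
have [i vi] := rV_neq0_entry v0.
pose m := [arg max_(j > i) `|v ord0 j|]%O.
have hm j : `|v ord0 j| <= `|v ord0 m|.
  by rewrite /m; case: arg_maxP => // k _; exact.
have vm : 0 < `|v ord0 m| by apply: lt_le_trans (hm i); rewrite normr_gt0.
rewrite -(ler_pM2r vm) -normrM.
have -> : a * v ord0 m = (v *m A) ord0 m by rewrite vA mxE.
rewrite mxE; apply: le_trans (ler_norm_sum _ _ _) _.
have -> : K%:R * c * `|v ord0 m| = \sum_(j < K) `|v ord0 m| * c.
  by rewrite sumr_const card_ord -[RHS]mulr_natl; ring.
by apply: ler_sum => j _; rewrite normrM ler_pM.
Qed.

Lemma posdef_eigenvalue_gt0 Q a : posdefmx Q -> eigenvalue Q a -> 0 < a.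
Proof.
move=> Qpd /eigenvalueP[v vQ v0].
have vT0 : v^T != 0 by rewrite -trmx0 (inj_eq trmx_inj).
have : 0 < a * (v *m v^T) ord0 ord0.
  have := qform_gt0 Qpd vT0.
  by rewrite /qform /bform trmxK vQ -scalemxAl mxE.
have n0 : 0 <= (v *m v^T) ord0 ord0.
  by rewrite mxE; apply: sumr_ge0 => j _; rewrite mxE -expr2 sqr_ge0.
nra.
Qed.

Lemma eigenvalue_invmx Q a : Q \in unitmx -> eigenvalue Q a ->
  eigenvalue (invmx Q) a^-1.
Proof.
move=> Qu /eigenvalueP[v vQ v0]; apply/eigenvalueP; exists v => //.
have a0 : a != 0.
  apply: contra_neq v0 => a0; rewrite -(mulmxK Qu v) vQ a0 scale0r.
  by rewrite mul0mx.
by rewrite -{1}(scalerK a0 v) -vQ -scalemxAl mulmxK.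
Qed.

End PosDef.

(** An eigenvalue exists over the complex numbers, and symmetry makes it real. *)
Lemma symmetric_has_eigenvalue {R : realType} (K : nat) (A : 'M[R]_K) :
  (0 < K)%N -> A^T = A -> exists a, eigenvalue A a.
Proof.
move=> K0 Asym; pose AC := map_mx (real_complex R) A.
have [z zA] := eigenvalue_closed AC K0.
have [v vA v0] := eigenvalueP zA.
have ACconj : map_mx Num.conj AC = AC.
  by apply/matrixP => i j; rewrite !mxE; exact: conjc_real.
pose w := map_mx Num.conj v.
have n0 : (v *m w^T) ord0 ord0 != 0.
  have [i vi] := rV_neq0_entry v0.
  rewrite mxE gt_eqF // (bigD1 i) //= !mxE ltr_pwDl //.
    by rewrite -normCK exprn_gt0 // normr_gt0.
  by apply: sumr_ge0 => j _; rewrite !mxE mul_conjC_ge0.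
have wA : w *m AC = Num.conj z *: w.
  by rewrite -{1}ACconj -map_mxM vA map_mxZ.
(* The scalar [v A w^T], with [w] the conjugate of [v], is computed in two ways; [v w^T] is the sum
   of the squared moduli of the entries, hence nonzero. *)
have zreal : z = Num.conj z.
  apply: (mulIf n0).
  have -> : z * (v *m w^T) ord0 ord0 = (v *m AC *m w^T) ord0 ord0.
    by rewrite vA -scalemxAl [RHS]mxE.
  have AT : AC^T = AC by apply/matrixP => i j; rewrite !mxE -{1}Asym mxE.
  have -> : v *m AC *m w^T = v *m (w *m AC)^T.
    by rewrite trmx_mul AT mulmxA.
  by rewrite wA linearZ /= -scalemxAr [LHS]mxE.
have [r zr] : exists r : R, z = real_complex R r.
  have : z \is Num.real by apply/CrealP.
  by case: (z) => x y; rewrite complex_real => /eqP ->; exists x.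
exists r; move: zA.
by rewrite zr !eigenvalue_root_char -map_char_poly fmorph_root.
Qed.

(** * Tail and origin exponents *)

Section Exponents.
Context {R : realType}.
Implicit Types (f : R -> R) (b : R).

(** * Logarithmic lower bounds from the exponents *)

Lemma itv_lb f (x y : R) : 0 < x -> x <= y ->
  {in `]0, +oo[, continuous f} ->
  exists C, forall s, x <= s <= y -> - C <= f s.
Proof.
move=> x0 xy fc.
have fw : {within `[x, y], continuous f}.
  apply: continuous_in_subspaceT => s; rewrite inE /= in_itv /= => /andP[xs _].
  by apply: fc; rewrite in_itv /= andbT (lt_le_trans x0 xs).
have [c _ hc] := EVT_min xy fw.
by exists (- f c) => s sxy; rewrite opprK; apply: hc; rewrite in_itv.
Qed.

Lemma powR_expR_lt1 (s a t : R) : 0 < s -> s `^ a * expR (- t) < 1 ->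
  a * ln s < t.
Proof.
by move=> s0; rewrite /powR gt_eqF // -expRD expR_lt1 subr_lt0.
Qed.

(** Some [a > b] makes the product tend to [0], hence eventually less than [1], which means
    [a / 2 * ln s < f s]. Since [ln s >= 0], [a] may be lowered to [b]; the remaining compact
    interval costs a constant. *)
Lemma tail_exponent_lb f b : {in `]0, +oo[, continuous f} ->
  (b%:E < tail_exponent f)%E ->
  exists C, forall s, 1 <= s -> b / 2 * ln s - C <= f s.
Proof.
move=> fc /ereal_sup_gt[_ [a fa <-]]; rewrite lte_fin => ba.
have [M [_ HM]] : \forall s \near +oo, s `^ (a / 2) * expR (- f s) < 1.
  exact: (cvgr_lt _ fa).
set T := Num.max M 1 + 1.
have T1 : 1 <= T by rewrite /T; case: (leP M 1) => h; lra.
have MT : M < T by rewrite /T; case: (leP M 1) => h; lra.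
have [C hC] := itv_lb ltr01 T1 fc.
exists (`|b / 2| * ln T + `|C|) => s s1.
have s0 : 0 < s by lra.
have lns : 0 <= ln s by exact: ln_ge0.
have lnT : 0 <= ln T by exact: ln_ge0.
have C0 := normr_ge0 C; have b0 := normr_ge0 (b / 2).
have [sT|Ts] := leP s T.
  have := hC s; rewrite s1 sT => /(_ isT) fs.
  have lnsT : ln s <= ln T by rewrite ler_ln ?posrE //; lra.
  have := ler_norm (b / 2); have := ler_norm C.
  nra.
have := powR_expR_lt1 s0 (HM s (lt_trans MT Ts)).
nra.
Qed.

(** The same argument near [0]: there [ln s <= 0], so an exponent [a < b] may be raised to [b]. *)
Lemma origin_exponent_lb f b : {in `]0, +oo[, continuous f} ->
  (origin_exponent f < b%:E)%E ->
  exists C, forall s, 0 < s <= 1 -> b / 2 * ln s - C <= f s.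
Proof.
move=> fc /ereal_inf_lt[_ [a fa <-]]; rewrite lte_fin => ab.
have : \forall s \near (0 : R)^'+, s `^ (a / 2) * expR (- f s) < 1.
  exact: (cvgr_lt _ fa).
move=> [/= e e0 He].
set T := Num.min (e / 2) 1.
have T1 : T <= 1 by rewrite /T; case: (leP (e / 2) 1) => h; lra.
have T0 : 0 < T by rewrite /T; case: (leP (e / 2) 1) => h; lra.
have Te : T < e by rewrite /T; case: (leP (e / 2) 1) => h; lra.
have [C hC] := itv_lb T0 T1 fc.
exists (`|b / 2| * - ln T + `|C|) => s /andP[s0 s1].
have lns : ln s <= 0 by exact: ln_le0.
have lnT : ln T <= 0 by exact: ln_le0.
have C0 := normr_ge0 C; have b0 := normr_ge0 (b / 2).
have [Ts|sT] := leP T s.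
  have := hC s; rewrite s1 Ts => /(_ isT) fs.
  have lnsT : ln T <= ln s by rewrite ler_ln ?posrE.
  have := ler_norm (- (b / 2)); have := ler_norm C; rewrite normrN.
  nra.
have := He s; rewrite /= sub0r normrN gtr0_norm // => /(_ (lt_trans sT Te) s0).
move/(powR_expR_lt1 s0); nra.
Qed.

(** Up to a constant, the minorant is piecewise linear in [ln s], with slope [b / 2] for [s >= 1]
    and [b' / 2] for [s <= 1]. *)
Definition log_minorized f b b' := exists C, forall s, 0 < s ->
  b / 2 * Num.max (ln s) 0 - b' / 2 * Num.max (- ln s) 0 - C <= f s.

Lemma exponents_log_minorized f b b' : {in `]0, +oo[, continuous f} ->
  (b%:E < tail_exponent f)%E -> (origin_exponent f < b'%:E)%E ->
  log_minorized f b b'.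
Proof.
move=> fc /(tail_exponent_lb fc)[C hC] /(origin_exponent_lb fc)[C' hC'].
exists (`|C| + `|C'|) => s s0.
have := ler_norm C; have := ler_norm C'.
have := normr_ge0 C; have := normr_ge0 C'.
have [s1|s1] := leP 1 s.
  have lns : 0 <= ln s by exact: ln_ge0.
  rewrite max_l // max_r ?oppr_le0 //; have := hC s s1; lra.
have lns : ln s <= 0 by apply/ln_le0/ltW.
rewrite max_r // max_l ?oppr_ge0 //; have := hC' s; rewrite s0 ltW //.
move=> /(_ isT); lra.
Qed.

(** Abel summation: [u] is [u 0] plus nonnegative increments, each multiplied by a tail sum of [g],
    which is at least [eps]; together with [u 0] the increments add up to [u n]. *)
Lemma abel_ge n (g u : nat -> R) eps :
  (forall m, (m <= n)%N -> eps <= \sum_(m <= i < n.+1) g i) ->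
  (forall i, (i < n)%N -> u i <= u i.+1) -> 0 <= u 0%N ->
  eps * u n <= \sum_(0 <= i < n.+1) g i * u i.
Proof.
elim: n g u => [|n IH] g u hg hu u0.
  by have := hg 0%N isT; rewrite !big_nat1 => h; exact: ler_wpM2r.
(* Index [0] is dropped and [u 0] subtracted; what is removed is [u 0] times the full sum of [g]. *)
have := IH (fun i => g i.+1) (fun i => u i.+1 - u 0%N).
move=> /(_ _ _ _)/wrap[||| H].
- move=> m mn; have := hg m.+1; rewrite ltnS mn => /(_ isT).
  by rewrite big_add1.
- by move=> i i_n; rewrite lerB // hu.
- by rewrite subr_ge0 hu.
have -> : \sum_(0 <= i < n.+2) g i * u i =
  u 0%N * (\sum_(0 <= i < n.+2) g i)
  + \sum_(0 <= i < n.+1) g i.+1 * (u i.+1 - u 0%N).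
  rewrite !(big_nat_recl n.+1) //= mulrDr mulr_sumr -addrA -big_split /=.
  by congr (_ + _); [rewrite mulrC | apply: eq_bigr => i _; ring].
have := ler_wpM2l u0 (hg 0%N isT); lra.
Qed.

(** A real sequence tending to [x] from strictly below; the value at [-oo] is a dummy, as the lemmas
    assume [-oo < x]. *)
Definition real_below (n : nat) (x : \bar R) : R :=
  match x with
  | EFin r => r - n.+1%:R^-1
  | +oo%E => n%:R
  | -oo%E => 0
  end.

Lemma real_below_lt n (x : \bar R) : (-oo < x)%E -> ((real_below n x)%:E < x)%E.
Proof.
by case: x => [r| |] //= _; rewrite ?ltry // lte_fin ltrBlDr ltrDl invr_gt0.
Qed.

Lemma real_below_cvg (x : \bar R) : (-oo < x)%E ->
  (real_below n x)%:E @[n --> \oo] --> x.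
Proof.
case: x => [r| |] //= _.
  apply: cvg_EFin; first exact: nearW.
  rewrite -[X in _ --> X]subr0; apply: cvgB; first exact: cvg_cst.
  exact: cvg_harmonic.
by apply/cvgenyP.
Qed.

(** The bound [-oo <] is carried through the induction because it keeps the extended sum well
    defined, so that addition is continuous there. *)
Lemma sum_real_below_cvg (I : Type) (s : seq I) (P : pred I) (a : I -> \bar R) :
  (forall i, -oo < a i)%E ->
  (-oo < \sum_(i <- s | P i) a i)%E /\
  (\sum_(i <- s | P i) real_below n (a i))%:E @[n --> \oo]
    --> (\sum_(i <- s | P i) a i)%E.
Proof.
move=> a0; elim: s => [|i s [IH0 IH]].
  rewrite big_nil; split; first by rewrite ltNyr.
  under eq_cvg do rewrite big_nil.
  exact: (@cvg_cst _ (0%E : \bar R) _ \oo _).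
rewrite big_cons; under eq_cvg do rewrite big_cons.
case: (P i); last by [].
split.
  by rewrite ltNye adde_eq_ninfty negb_or -!ltNye a0.
under eq_cvg do rewrite EFinD.
apply: cvgeD => //; last exact: real_below_cvg.
by apply: ltninfty_adde_def; rewrite inE.
Qed.

(* Finitely many strict inequalities survive a simultaneous small decrease of
   the [a j]; only the pairs of a subset and a bound matter. *)
Lemma real_minorants (J : finType) m (c : 'I_m -> R) (a : J -> \bar R) :
  (forall j, -oo < a j)%E ->
  exists b : J -> R, (forall j, (b j)%:E < a j)%E /\
    forall (T : {set J}) d, ((c d)%:E < \sum_(j in T) a j)%E ->
      c d < \sum_(j in T) b j.
Proof.
move=> a0.
have : \forall n \near \oo, forall (T : {set J}) d,
    ((c d)%:E < \sum_(j in T) a j)%E -> c d < \sum_(j in T) real_below n (a j).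
  (* There are finitely many pairs [(T, d)], so eventual validity for each gives it for all at
     once. *)
  apply: filter_forall => T; apply: filter_forall => d.
  have [ca|/negP nca] := boolP ((c d)%:E < \sum_(j in T) a j)%E; last first.
    by apply: nearW => n ca; case: nca.
  have [_ cvgT] := sum_real_below_cvg (index_enum J) (mem T) a0.
  have : \forall n \near \oo, 
    ((c d)%:E < (\sum_(j in T) real_below n (a j))%:E)%E.
    apply: (cvgT [set y | ((c d)%:E < y)%E]).
    by apply: open_nbhs_nbhs; split; first exact: open_ereal_gt_ereal.
  by apply: filterS => n; rewrite lte_fin.
move=> [n _ /(_ n (leqnn n)) hn].
by exists (fun j => real_below n (a j)); split => // j; exact: real_below_lt.
Qed.

End Exponents.

(** * Flags adapted to a quadratic form *)

Section Flags.
Context {R : realType} {K : nat}.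
Local Notation vec := 'cV[R]_K.

Lemma mxrange_subvP m (A : 'M[R]_(K, m)) (S : {vspace vec}) :
  reflect (forall c, col c A \in S) (mxrange A <= S)%VS.
Proof.
apply: (iffP subvP) => [AS c|AS v /memv_imgP[u _ ->]].
  rewrite colE -[_ *m _](lfunE (mulmx A : 'cV_m -> vec)).
  by apply: AS; rewrite memv_img ?memvf.
rewrite lfunE /= [u](matrix_sum_delta) mulmx_sumr memv_suml // => i _.
rewrite mulmx_sumr memv_suml // => j _; rewrite ord1 -scalemxAr memvZ //.
by rewrite -colE.
Qed.

Lemma mxrange_sub0 m (A : 'M[R]_(K, m)) : (mxrange A <= 0)%VS = (A == 0).
Proof.
apply/mxrange_subvP/eqP => [A0|-> c]; last first.
  by rewrite memv0; apply/eqP/colP => i; rewrite !mxE.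
apply/matrixP => i c; have := A0 c; rewrite memv0 => /eqP/colP/(_ i).
by rewrite !mxE.
Qed.

Lemma dim_cV : \dim (fullv : {vspace vec}) = K.
Proof. by rewrite dimvf /dim /= muln1. Qed.

(** A basis given as a list, whose prefixes span a complete flag [V_0 < V_1 < ... < V_K]. *)
Definition flag_seq (s : seq vec) :=
  size s = K /\ forall m, (m < K)%N -> s`_m \notin <<take m s>>%VS.

Lemma flag_free s m : flag_seq s -> (m <= K)%N -> free (take m s).
Proof.
move=> [sK hs]; elim: m => [|m IH] mK; first by rewrite take0 nil_free.
rewrite (take_nth 0) ?sK //.
rewrite (perm_free (Y := s`_m :: take m s)) ?perm_rcons //.
by rewrite free_cons hs //= IH // ltnW.
Qed.

Lemma dim_flag s m : flag_seq s -> (m <= K)%N -> \dim <<take m s>> = m.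
Proof.
move=> hs mK; have := flag_free hs mK; rewrite /free => /eqP->.
by rewrite size_takel // hs.1.
Qed.

Lemma flag_take s : flag_seq s -> take K s = s.
Proof. by move=> hs; rewrite take_oversize // hs.1. Qed.

Lemma flag_full s v : flag_seq s -> v \in << s >>%VS.
Proof.
move=> hs; suff -> : << s >>%VS = fullv by rewrite memvf.
apply/eqP; rewrite eqEdim subvf dim_cV.
by rewrite -{1}(flag_take hs) dim_flag /=.
Qed.

Lemma flag_subv (s : seq vec) m m' : (m <= m')%N ->
  (<<take m s>> <= <<take m' s>>)%VS.
Proof.
move=> mm'; apply: sub_span => x; rewrite -(take_takel s mm').
exact: mem_take.
Qed.

(** The least prefix whose span contains the range exists because [V_K] is everything, and it is not
    [V_0] because [A] is nonzero; [m] is its predecessor. *)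
Lemma flag_level s n (A : 'M[R]_(K, n)) : flag_seq s -> A != 0 ->
  exists m : 'I_K, forall m', (m' <= K)%N ->
    (mxrange A <= <<take m' s>>)%VS = (m < m')%N.
Proof.
move=> hs A0; pose P m := (mxrange A <= <<take m s>>)%VS.
have PK : exists m, P m.
  exists K; rewrite /P flag_take //; apply/mxrange_subvP => c.
  exact: flag_full.
case: (ex_minnP PK) => -[|m] Pm minm.
  by move: Pm; rewrite /P take0 span_nil mxrange_sub0 (negbTE A0).
have mK : (m < K)%N.
  apply: minm; rewrite /P flag_take //; apply/mxrange_subvP => c.
  exact: flag_full.
exists (Ordinal mK) => m' m'K /=; apply/idP/idP => [|mm']; first exact: minm.
exact: subv_trans Pm (flag_subv _ mm').
Qed.

(* [s] is a basis chosen greedily: each vector minimises [q] among the [X i]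
   outside the span of the previous ones. *)
Definition adapted (I : Type) (X : I -> vec) (q : vec -> R) (s : seq vec) :=
  forall m i, (m < K)%N -> X i \notin <<take m s>>%VS -> q s`_m <= q (X i).

(** The greedy construction returns a tuple of indices in a finite type, so only finitely many flags
    can arise whatever [q] is. *)
Lemma adapted_flag_exists (I : finType) (X : I -> vec) (q : vec -> R) :
  (forall S : {vspace vec}, (forall i, X i \in S) -> (fullv <= S)%VS) ->
  exists t : K.-tuple I,
    flag_seq (map X t) /\ adapted X q (map X t).
Proof.
move=> Xfull.
suff H n : (n <= K)%N -> exists t : seq I, size t = n /\
    forall m, (m < n)%N -> (map X t)`_m \notin <<take m (map X t)>>%VS /\
    forall i, X i \notin <<take m (map X t)>>%VS ->
      q (map X t)`_m <= q (X i).
  have [t [tK ht]] := H K (leqnn K).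
  exists (tcast tK (in_tuple t)); rewrite val_tcast /=.
  split; first by split => [|m /ht[]//]; rewrite size_map.
  by move=> m i /ht[_]; apply.
elim: n => [|n IH] nK; first by exists [::].
have [t [tn ht]] := IH (ltnW nK).
set V := <<map X t>>%VS.
(* Fewer than [K] vectors cannot span, so a candidate remains to be chosen. *)
have [i0 Xi0] : exists i, X i \notin V.
  apply/existsP; rewrite -negb_forall; apply/negP => /forallP /Xfull VX.
  have := dimvS VX; rewrite dim_cV leqNgt.
  by rewrite (leq_ltn_trans (dim_span _)) // size_map tn.
case: (@arg_minP _ _ I i0 (fun i => X i \notin V) (fun i => q (X i))
  Xi0) => i Xi mini.
exists (rcons t i); split; first by rewrite size_rcons tn.
move=> m; rewrite ltnS leq_eqVlt map_rcons => /orP[/eqP->|mn].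
  by rewrite nth_rcons size_map tn ltnn eqxx -cats1 take_size_cat ?size_map.
rewrite nth_rcons size_map tn mn -cats1 takel_cat ?size_map ?tn 1?ltnW //.
exact: ht.
Qed.

Lemma mxtrace_qform m (Q : 'M[R]_K) (A : 'M[R]_(K, m)) :
  \tr (A^T *m Q *m A) = \sum_c qform Q (col c A).
Proof.
apply: eq_bigr => c _.
rewrite /qform /bform tr_col -row_mul [LHS]mxE [RHS]mxE.
by apply: eq_bigr => k _; rewrite !mxE.
Qed.

Lemma flag_det_neq0 s : flag_seq s ->
  \det (\matrix_(i < K, j < K) s`_j i ord0) != 0.
Proof.
move=> hs; apply/negP; rewrite -det_tr => /det0P[v v0 vB].
have sz : size s == K by rewrite hs.1.
have := flag_free hs (leqnn K); rewrite flag_take //.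
move=> /(@freeP _ _ _ (Tuple sz)) /= /(_ (fun i => v ord0 i)) hv.
case/eqP: v0; apply/rowP => i; rewrite [RHS]mxE; apply: hv.
apply/colP => k; move/rowP: vB => /(_ k); rewrite !mxE => <-.
by rewrite summxE; apply: eq_bigr => j _; rewrite !mxE.
Qed.

End Flags.

(* Applied to such a line, the in-subspace condition forces [0 < g]. *)
Lemma generic_line {R : realType} (K : nat) (J : finType) (p : J -> nat)
    (M : forall j, 'M[R]_(K, p j)) : (1 < K)%N -> (forall j, M j != 0) ->
  exists S : {vspace 'cV[R]_K}, \dim S = 1%N /\
    forall j, ~~ (mxrange (M j) <= S)%VS.
Proof.
move=> K1 M0; pose i0 := Ordinal (ltnW K1); pose i1 := Ordinal K1.
pose v (t : nat) : 'cV[R]_K := delta_mx i0 ord0 + t%:R *: delta_mx i1 ord0.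
have v0 t : v t i0 ord0 = 1 by rewrite !mxE /= mulr0 addr0.
have v1 t : v t i1 ord0 = t%:R by rewrite !mxE /= mulr1 add0r.
(* Pigeonhole: the lines [<[v t]>] are pairwise distinct, since [v t] has first coordinate [1] and
   second [t]. A nonzero range fits in at most one of them, and there is one line more than there
   are matrices. *)
suff [t ht] : exists t : 'I_#|J|.+1, forall j, ~~ (mxrange (M j) <= <[v t]>)%VS.
  exists <[v t]>%VS; split => //; rewrite dim_vline.
  suff -> : v t != 0 by [].
  by apply: contra_neq (oner_neq0 R) => vt; rewrite -(v0 t) vt mxE.
apply: contrapT => /forallNP H.
have {}H (t : 'I_#|J|.+1) : exists j, (mxrange (M j) <= <[v t]>)%VS.
  by apply: contrapT => /forallNP Ht; apply: (H t) => j; apply/negP.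
have [g hg] := fin_all_exists H.
have : injective g.
  move=> t t' gt; apply/val_inj/eqP; rewrite -(eqr_nat R) /=.
  have [c Mc] : exists c, col c (M (g t)) != 0.
    apply/existsP; rewrite -negb_forall; apply: contra (M0 (g t)).
    move/forallP => h; apply/eqP/matrixP => i c.
    by have /eqP/colP/(_ i) := h c; rewrite !mxE.
  have /mxrange_subvP/(_ c)/vlineP[k kE] := hg t.
  move: (hg t'); rewrite -gt => /mxrange_subvP/(_ c)/vlineP[k' k'E].
  have kv : k *: v t = k' *: v t' by rewrite -kE -k'E.
  have k0 : k != 0 by apply: contra_neq Mc => k0; rewrite kE k0 scale0r.
  have kk' : k = k'.
    by move/colP/(_ i0): kv; rewrite [LHS]mxE [RHS]mxE !v0 !mulr1.
  by move/colP/(_ i1): kv; rewrite [LHS]mxE [RHS]mxE !v1 -kk' => /(mulfI k0) ->.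
by move/leq_card; rewrite card_ord ltnn.
Qed.

(** * Bounds along a fixed flag *)

Lemma maxr0_le {R : realDomainType} (x y : R) : x <= y ->
  Num.max x 0 <= Num.max y 0.
Proof. by move=> xy; rewrite ge_max !le_max xy lexx orbT. Qed.

Section FlagSums.
Context {R : realType} {J : finType}.

Lemma sum_nat_fibers (m : J -> nat) (F : J -> R) k n :
  (forall j, (m j < n)%N) ->
  \sum_(k <= i < n) \sum_(j | m j == i) F j = \sum_(j | (k <= m j)%N) F j.
Proof.
move=> mn; rewrite (exchange_big_dep xpredT) //= [RHS]big_mkcond /=.
apply: eq_bigr => j _; under eq_bigl do rewrite eq_sym.
by rewrite big_nat1_eq mn andbT.
Qed.

(** Grouping the [b j] by level [m j] makes the coefficient at [i] the sum of its fiber minus [g];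
    its tail sums are those in the hypothesis. *)
Lemma weighted_abel n (m : J -> nat) (b : J -> R) (g eps : R) (u : nat -> R) :
  (forall j, (m j <= n)%N) ->
  (forall k, (k <= n)%N ->
    eps <= \sum_(j | (k <= m j)%N) b j - g * (n.+1 - k)%:R) ->
  (forall i, (i < n)%N -> u i <= u i.+1) -> 0 <= u 0%N ->
  eps * u n <= \sum_j b j * u (m j) - g * \sum_(0 <= i < n.+1) u i.
Proof.
move=> mn hb hu u0.
have := @abel_ge R n (fun i => \sum_(j | m j == i) b j - g) u eps.
move=> /(_ _ hu u0)/wrap[k kn|].
  by rewrite sumrB sum_nat_fibers // sumr_const_nat -mulr_natr hb.
move=> /le_trans; apply; rewrite le_eqVlt; apply/orP; left; apply/eqP.
rewrite mulr_sumr.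
have <- : \sum_(0 <= i < n.+1) \sum_(j | m j == i) b j * u (m j)
  = \sum_j b j * u (m j) by rewrite sum_nat_fibers.
rewrite -sumrB; apply: eq_bigr => i _; rewrite mulrBl mulr_suml.
by congr (_ - _); apply: eq_bigr => j /eqP ->.
Qed.

(** Positive and negative parts of [w] are treated separately: the former increase along the flag,
    the latter increase when the flag is read backwards. *)
Lemma flag_linear_bound n (m : J -> nat) (b b' : J -> R) (g eps : R)
    (w : nat -> R) :
  (forall j, (m j <= n)%N) ->
  (forall k, (k <= n)%N ->
    eps <= \sum_(j | (k <= m j)%N) b j - g * (n.+1 - k)%:R) ->
  (forall k, (k <= n)%N ->
    eps <= g * (n.+1 - k)%:R - \sum_(j | (m j <= n - k)%N) b' j) ->
  (forall i, (i < n)%N -> w i <= w i.+1) ->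
  eps * (Num.max (w n) 0 + Num.max (- w 0%N) 0) <=
  \sum_j (b j * Num.max (w (m j)) 0 - b' j * Num.max (- w (m j)) 0)
  - g * \sum_(0 <= i < n.+1) w i.
Proof.
move=> mn hb hb' hw.
have := @weighted_abel n m b g eps (fun i => Num.max (w i) 0) mn hb.
move=> /(_ _ _)/wrap[i i_n||H1].
- by rewrite maxr0_le ?hw.
- by rewrite le_max lexx orbT.
(* Reversal [i -> n - i], with the signs of [b'] and [g] changed. *)
have := @weighted_abel n (fun j => n - m j)%N (fun j => - b' j) (- g) eps
  (fun i => Num.max (- w (n - i)%N) 0).
move=> /(_ _ _ _ _)/wrap[j|k kn|i i_n||H2].
- exact: leq_subr.
- have := hb' k kn; rewrite sumrN mulNr opprK addrC => /le_trans; apply.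
  rewrite lerD2r lerN2 le_eqVlt; apply/orP; left; apply/eqP.
  by apply: eq_bigl => j; move: (mn j) => mj; apply/idP/idP; lia.
- rewrite maxr0_le // lerN2 -[in leRHS](@prednK (n - i)) ?subn_gt0 //.
  by rewrite -subnS hw // ltn_subrL /=; lia.
- by rewrite le_max lexx orbT.
move: H2; rewrite /= subnn => /(lerD H1); rewrite -mulrDr => /le_trans; apply.
rewrite sumrB.
have -> : \sum_j - b' j * Num.max (- w (n - (n - m j))%N) 0
  = - \sum_j b' j * Num.max (- w (m j)) 0.
  by rewrite -sumrN; apply: eq_bigr => j _; rewrite subKn // mulNr.
have -> : \sum_(0 <= i < n.+1) Num.max (- w (n - i)%N) 0
  = \sum_(0 <= i < n.+1) Num.max (- w i) 0.
  by rewrite [RHS]big_nat_rev /=; apply: eq_bigr => i _; rewrite add0n subSS.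
have -> : \sum_(0 <= i < n.+1) w i =
  \sum_(0 <= i < n.+1) Num.max (w i) 0
  - \sum_(0 <= i < n.+1) Num.max (- w i) 0.
  rewrite -sumrB; apply: eq_bigr => i _.
  by case: (leP (w i) 0) => h; [rewrite max_l | rewrite max_r]; lra.
lra.
Qed.

Lemma min_pos_finite n (h : nat -> R) : (forall k, (k <= n)%N -> 0 < h k) ->
  exists2 e, 0 < e & forall k, (k <= n)%N -> e <= h k.
Proof.
elim: n => [|n IH] hp; first by exists (h 0%N) => [|[]//]; exact: hp.
have [e e0 he] := IH (fun k kn => hp k (leqW kn)).
exists (Num.min e (h n.+1)) => [|k]; first by rewrite lt_min e0 hp.
rewrite leq_eqVlt => /orP[/eqP->|kn]; first by rewrite ge_min lexx orbT.
by rewrite ge_min he.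
Qed.

End FlagSums.

Lemma ln_inv_mul_exp {R : realType} (d k q : R) n : 0 < d -> 0 < k -> 0 < q ->
  ln (d^-1 * k * q ^+ n) = - ln d + ln k + n%:R * ln q.
Proof.
move=> d0 k0 q0.
have dV0 : 0 < d^-1 by rewrite invr_gt0.
rewrite lnM ?posrE ?exprn_gt0 ?(mulr_gt0 dV0 k0) // lnM ?posrE //.
by rewrite lnV ?posrE // lnXn // mulr_natl.
Qed.

Section FlagBounds.
Context {R : realType} {n : nat}.
Local Notation K := n.+1.
Context {I : Type} (X : I -> 'cV[R]_K) (s : seq 'cV[R]_K).
Hypothesis s_flag : flag_seq s.
Hypothesis s_in : forall m, (m < K)%N -> exists i, s`_m = X i.

(** [Q] stands for the inverse of [Sigma]. The flag [s] is fixed and [Q] ranges over the forms for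
    which it is greedy; the constants below depend on [s] but not on [Q]. *)
Definition flag_form (Q : 'M[R]_K) :=
  posdefmx Q /\ adapted X (qform Q) s.

Definition log_flag (Q : 'M[R]_K) m := ln (qform Q s`_m).

Lemma flag_form_gt0 Q m : flag_form Q -> (m < K)%N -> 0 < qform Q s`_m.
Proof.
move=> [Qpd _] mK; apply: qform_gt0 => //.
by apply: contraNneq (s_flag.2 _ mK) => ->; exact: mem0v.
Qed.

(** The later vector was already a candidate when [s_m] was chosen. *)
Lemma flag_form_le Q m m' : flag_form Q -> (m <= m')%N -> (m' < K)%N ->
  qform Q s`_m <= qform Q s`_m'.
Proof.
move=> [_ hQ] mm' m'K; have [i iE] := s_in m'K; rewrite iE.
apply: hQ; first exact: leq_ltn_trans mm' m'K.
rewrite -iE; apply: contra (s_flag.2 _ m'K).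
by apply/subvP; exact: flag_subv.
Qed.

Lemma log_flag_le Q m : flag_form Q -> (m < n)%N ->
  log_flag Q m <= log_flag Q m.+1.
Proof.
move=> hQ mn; rewrite ler_ln ?posrE ?flag_form_gt0 ?flag_form_le //.
exact: ltnW.
Qed.

Lemma qform_flag_le m x : (m < K)%N -> x \in <<take m.+1 s>>%VS ->
  exists2 C, 0 < C & forall Q, flag_form Q -> qform Q x <= C * qform Q s`_m.
Proof.
move=> mK /qform_span_le[C C0 hC]; exists C => // Q hQ.
apply: hC; [exact: hQ.1 | exact/ltW/flag_form_gt0 | move=> y].
move=> ys; have [i + <-] := nthP 0 ys; rewrite size_takel ?s_flag.1 // => im.
by rewrite nth_take // flag_form_le.
Qed.

(** The trace is the sum of [q] over the columns. A column outside [V_m] was a candidate at step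
    [m], whence the lower bound; all columns lie in [V_(m+1)], whence the upper one. *)
Lemma trace_flag_bounds d (A : 'M[R]_(K, d)) m :
  (forall c, exists i, X i = col c A) -> (m < K)%N ->
  ~~ (mxrange A <= <<take m s>>)%VS -> (mxrange A <= <<take m.+1 s>>)%VS ->
  exists2 C, 0 <= C & forall Q, flag_form Q ->
    log_flag Q m <= ln (\tr (A^T *m Q *m A)) <= log_flag Q m + C /\
    0 < \tr (A^T *m Q *m A).
Proof.
move=> AX mK Am /mxrange_subvP Am1.
have [c0 hc0] : exists c, col c A \notin <<take m s>>%VS.
  by apply/existsP; rewrite -negb_forall; apply: contra Am => /forallP ?;
    apply/mxrange_subvP.
have [C hC0 hC] := fin_all_exists2 (fun c => qform_flag_le mK (Am1 c)).
have C0 : 0 < \sum_c C c.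
  by rewrite (bigD1 c0) //= ltr_pwDl ?sumr_ge0 // => c _; apply/ltW.
have [i0 i0E] := AX c0.
have lo Q : flag_form Q -> qform Q s`_m <= \tr (A^T *m Q *m A).
  move=> [Qpd hQ]; rewrite mxtrace_qform (bigD1 c0) //=.
  rewrite -[leLHS]addr0 lerD //; first by rewrite -i0E hQ // i0E.
  by apply: sumr_ge0 => c _; exact: qform_ge0.
(* The [1 +] makes this logarithm nonnegative. *)
exists (ln (1 + \sum_c C c)) => [|Q hQ].
  by apply: ln_ge0; rewrite lerDl ltW.
have q0 := flag_form_gt0 hQ mK.
have tr0 : 0 < \tr (A^T *m Q *m A) by exact: lt_le_trans q0 (lo Q hQ).
split=> //; rewrite ler_ln ?posrE // lo //= -lnM ?posrE ?ltr_wpDl //.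
rewrite ler_ln ?posrE ?mulr_gt0 ?ltr_wpDl //.
rewrite mxtrace_qform mulrDr mulr1 ler_wpDl // ?(ltW q0) // mulr_sumr.
by apply: ler_sum => c _; rewrite mulrC hC.
Qed.

(** Positive and negative parts are 1-Lipschitz, so replacing the logarithm of the trace by
    [log_flag] costs a bounded amount. *)
Lemma log_minorized_trace d (A : 'M[R]_(K, d)) m (f : R -> R) b b' :
  (forall c, exists i, X i = col c A) -> (m < K)%N ->
  ~~ (mxrange A <= <<take m s>>)%VS -> (mxrange A <= <<take m.+1 s>>)%VS ->
  log_minorized f b b' ->
  exists C, forall Q, flag_form Q ->
    b / 2 * Num.max (log_flag Q m) 0 - b' / 2 * Num.max (- log_flag Q m) 0 - C
    <= f (\tr (A^T *m Q *m A)).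
Proof.
move=> AX mK Am Am1 [C hC].
have [C' C'0 hC'] := trace_flag_bounds AX mK Am Am1.
exists (C + `|b / 2| * C' + `|b' / 2| * C') => Q /hC'[/andP[h1 h2] t0].
apply: le_trans (hC _ t0).
move: h1 h2; set w := log_flag Q m; set z := ln _ => h1 h2.
have e1 : `|Num.max w 0 - Num.max z 0| <= C'.
  by rewrite ler_norml; case: (leP w 0); case: (leP z 0) => *; lra.
have e2 : `|Num.max (- w) 0 - Num.max (- z) 0| <= C'.
  by rewrite ler_norml; case: (leP (- w) 0); case: (leP (- z) 0) => *; lra.
have := ler_norm (b / 2 * (Num.max w 0 - Num.max z 0)).
have := ler_norm (- (b' / 2 * (Num.max (- w) 0 - Num.max (- z) 0))).
rewrite normrN !normrM => g1 g2.
have := ler_wpM2l (normr_ge0 (b / 2)) e1.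
have := ler_wpM2l (normr_ge0 (b' / 2)) e2.
rewrite !normrM; lra.
Qed.

Lemma expR_sum_log_flag Q : flag_form Q ->
  \prod_(i < K) qform Q s`_i = expR (\sum_(0 <= i < K) log_flag Q i).
Proof.
move=> hQ; rewrite big_mkord expR_sum; apply: eq_bigr => i _.
by rewrite /log_flag lnK // posrE flag_form_gt0.
Qed.

(** Logarithm of the Hadamard bound for the matrix [B] whose columns are the flag vectors; [\det B]
    is nonzero and independent of [Q]. *)
Lemma flag_det_ub : exists C, forall Q, flag_form Q ->
  ln (\det Q) <= \sum_(0 <= i < K) log_flag Q i + C.
Proof.
have B0 := flag_det_neq0 s_flag; set B := (\matrix_(_, _) _) in B0.
exists (ln K`!%:R - ln (\det B ^+ 2)) => Q hQ; have [Qpd _] := hQ.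
have dQ := posdef_det_gt0 Qpd.
have B2 : 0 < \det B ^+ 2 by rewrite exprn_even_gt0.
have K0 : 0 < K`!%:R :> R by rewrite ltr0n fact_gt0.
rewrite addrA lerBrDr -lnM ?posrE // -[X in X + _]expRK addrC.
rewrite -lnM ?posrE ?expR_gt0 // ler_ln ?posrE;
  rewrite ?(mulr_gt0 dQ B2) ?(mulr_gt0 K0 (expR_gt0 _)) //.
rewrite -expR_sum_log_flag //; apply: le_trans (posdef_det_le B Qpd) _.
rewrite ler_pM2l // le_eqVlt; apply/orP; left; apply/eqP.
apply: eq_bigr => i _; congr (qform Q _); apply/colP => k.
by rewrite !mxE.
Qed.

(** In dimension one the Gram determinant of the flag is the form itself, so the Hadamard bound has
    a converse. *)
Lemma flag_det_lb1 : n = 0%N -> exists C, forall Q, flag_form Q ->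
  \sum_(0 <= i < K) log_flag Q i <= ln (\det Q) + C.
Proof.
move=> n0; exists (ln (s`_0 ord0 ord0 ^+ 2)) => Q hQ.
have q0 := flag_form_gt0 hQ (ltn0Sn n).
have [Qpd _] := hQ; have dQ := posdef_det_gt0 Qpd.
have qE : qform Q s`_0 = \det Q * s`_0 ord0 ord0 ^+ 2.
  move: (Q) (s`_0) => {Q hQ q0 Qpd dQ}; rewrite n0 => Q v.
  rewrite det_mx11 /qform /bform mxE big_ord1 mxE big_ord1 mxE; ring.
have s0 : 0 < s`_0 ord0 ord0 ^+ 2 by rewrite -(pmulr_rgt0 _ dQ) -qE.
have -> : \sum_(0 <= i < K) log_flag Q i = log_flag Q 0.
  by rewrite n0 big_nat1.
by rewrite /log_flag qE lnM ?posrE.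
Qed.

(** Standard basis vectors lie in the span of the whole flag, whose largest value of [q] is at
    [s_n]. *)
Lemma flag_entry_le : exists2 C, 0 < C & forall Q i j, flag_form Q ->
  `|Q i j| <= C * qform Q s`_n.
Proof.
have full x : x \in <<take n.+1 s>>%VS by rewrite flag_take // flag_full.
have [C hC0 hC] := fin_all_exists2 (fun k : 'I_K =>
  qform_flag_le (ltnSn n) (full (delta_mx k ord0))).
have C0 : 0 < \sum_c C c.
  by rewrite (bigD1 ord0) //= ltr_pwDl ?sumr_ge0 // => c _; apply/ltW.
exists (\sum_c C c) => // Q i j hQ; have [Qpd _] := hQ.
apply: posdef_entry_le => // k; apply: le_trans (hC k Q hQ) _.
rewrite ler_wpM2r //; first exact/ltW/flag_form_gt0.
by rewrite (bigD1 k) //= lerDl sumr_ge0 // => c _; exact/ltW.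
Qed.

(** The first bound holds since [a^-1] is an eigenvalue of [Q], whose entries are controlled by
    [q(s_n)]; the second estimates the entries of [Sigma] by Cramer's rule. *)
Lemma flag_eigenvalue_bounds : exists C, forall Sigma a,
  posdefmx Sigma -> flag_form (invmx Sigma) -> eigenvalue Sigma a ->
  - ln a <= log_flag (invmx Sigma) n + C /\
  ln a <= - ln (\det (invmx Sigma)) + n%:R * log_flag (invmx Sigma) n + C.
Proof.
have [C C0 hC] := flag_entry_le.
exists (`|ln (K%:R * C)| + `|ln (K%:R * n`!%:R * C ^+ n)|) => Sigma a Spd hQ ea.
set Q := invmx Sigma in hQ *; have [Qpd _] := hQ.
have a0 := posdef_eigenvalue_gt0 Spd ea.
have q0 := flag_form_gt0 hQ (ltnSn n).
have dQ := posdef_det_gt0 Qpd.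
have K0 : 0 < K%:R :> R by rewrite ltr0n.
have F0 : 0 < n`!%:R :> R by rewrite ltr0n fact_gt0.
have l1 := ler_norm (ln (K%:R * C)).
have l2 := ler_norm (ln (K%:R * n`!%:R * C ^+ n)).
have l3 := normr_ge0 (ln (K%:R * C)).
have l4 := normr_ge0 (ln (K%:R * n`!%:R * C ^+ n)).
split.
  have := eigenvalue_le (fun i j => hC Q i j hQ)
    (eigenvalue_invmx (posdef_unitmx Spd) ea).
  rewrite gtr0_norm ?invr_gt0 // -ler_ln ?posrE ?invr_gt0 ?mulr_gt0 //.
  by rewrite lnV ?posrE // mulrA lnM ?posrE ?mulr_gt0 // -/(log_flag Q n); lra.
pose c := C * qform Q s`_n; have c0 : 0 < c by rewrite mulr_gt0.
have Sc i j : `|Sigma i j| <= (\det Q)^-1 * (n`!%:R * c ^+ n).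
  rewrite -[Sigma]invmxK -/Q /invmx posdef_unitmx // mxE normrM.
  rewrite gtr0_norm ?invr_gt0 // ler_pM2l ?invr_gt0 // mxE /cofactor.
  rewrite normrM normrX normrN1 expr1n mul1r.
  (* A cofactor is up to sign a minor of size [n], with all entries at most [c]. *)
  have := @normr_det_le _ _ (row' j (col' i Q)) (fun=> c) (fun=> 1).
  rewrite !prodr_const card_ord expr1n !mulr1; apply=> [k l|_]; last exact: ltW.
  by rewrite !mxE hC.
have := eigenvalue_le Sc ea; rewrite gtr0_norm //.
have -> : K%:R * ((\det Q)^-1 * (n`!%:R * c ^+ n)) =
  (\det Q)^-1 * (K%:R * n`!%:R * C ^+ n) * qform Q s`_n ^+ n.
  by rewrite /c exprMn; ring.
set k := K%:R * n`!%:R * C ^+ n in l2 l4 *.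
have k0 : 0 < k by rewrite !mulr_gt0 ?exprn_gt0.
have P0 : 0 < (\det Q)^-1 * k * qform Q s`_n ^+ n.
  by rewrite !mulr_gt0 ?invr_gt0 ?exprn_gt0.
move=> aP; have : ln a <= ln ((\det Q)^-1 * k * qform Q s`_n ^+ n).
  by rewrite ler_ln ?posrE.
rewrite ln_inv_mul_exp // -/(log_flag Q n); lra.
Qed.

End FlagBounds.

(** * Coercivity *)

(** [Ltilde] in uniform notation, with [g = N + 2 alpha] and [J] indexing samples and matrices
    together. *)
Definition log_objective {R : realType} (K : nat) (J : finType) (p : J -> nat)
    (M : forall j, 'M[R]_(K, p j)) (f : J -> R -> R) (g : R)
    (Sigma : 'M[R]_K) : R :=
  g / 2 * ln (\det Sigma)
  + \sum_j f j (\tr ((M j)^T *m invmx Sigma *m M j)).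

(** A single natural number encodes both slope and offset, so that the bounds for finitely many
    flags can be merged by a maximum. *)
Lemma ler_abs_weight {R : realType} (eta T y L : R) : 0 < eta -> 0 <= T ->
  forall N : nat, eta^-1 + T < N%:R -> 0 <= y -> eta * y - T <= L ->
  y / N.+1%:R - N%:R <= L.
Proof.
move=> eta0 T0 N NT y0; apply: le_trans.
have eV : 0 < eta^-1 by rewrite invr_gt0.
have N0 : 0 < N.+1%:R :> R by rewrite ltr0n.
have : N.+1%:R^-1 <= eta.
  rewrite -[eta]invrK lef_pV2 ?posrE //.
  by rewrite -addn1 natrD; lra.
by move=> /(ler_wpM2r y0); rewrite mulrC; move: (y / _) => z; lra.
Qed.

Section Coercivity.
Context {R : realType} {n : nat} {J : finType} {p : J -> nat}.
Local Notation K := n.+1.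
Variables (M : forall j, 'M[R]_(K, p j)) (f : J -> R -> R) (b b' : J -> R).
Variable g : R.
Hypothesis M_neq0 : forall j, M j != 0.
Hypothesis f_min : forall j, log_minorized (f j) (b j) (b' j).
Hypothesis out_cond : forall S : {vspace 'cV[R]_K}, (\dim S < K)%N ->
  g * (K%:R - (\dim S)%:R) < \sum_(j | ~~ (mxrange (M j) <= S)%VS) b j.
Hypothesis in_cond : forall S : {vspace 'cV[R]_K}, (0 < \dim S)%N ->
  \sum_(j | (mxrange (M j) <= S)%VS) b' j < g * (\dim S)%:R.

Lemma flag_coercive (I : Type) (X : I -> 'cV[R]_K) (s : seq 'cV[R]_K) :
  flag_seq s ->
  (forall m, (m < K)%N -> exists i, s`_m = X i) ->
  (forall j c, exists i, X i = col c (M j)) ->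
  exists N : nat, forall Sigma a, posdefmx Sigma ->
    adapted X (qform (invmx Sigma)) s -> eigenvalue Sigma a ->
    `|ln a| / N.+1%:R - N%:R <= log_objective M f g Sigma.
Proof.
move=> hs s_in M_in.
have [m hm] := fin_all_exists (fun j => flag_level hs (M_neq0 j)).
(* The condition is applied to [V_k], including the zero subspace at [k = 0]. *)
have [e1 e1_gt0 he1] : exists2 e, 0 < e & forall k, (k <= n)%N ->
    e <= \sum_(j | (k <= m j)%N) b j - g * (K - k)%:R.
  apply: min_pos_finite => k kn; have kK : (k <= K)%N by exact: leqW.
  rewrite subr_gt0 natrB //.
  have := out_cond (S := <<take k s>>%VS); rewrite dim_flag //.
  move=> /(_ kn)/lt_le_trans; apply.
  rewrite le_eqVlt; apply/orP; left; apply/eqP; apply: eq_bigl => j.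
  by rewrite hm // -leqNgt.
(* Here the subspace is [V_(K-k)], which is the whole space at [k = 0]. *)
have [e2 e2_gt0 he2] : exists2 e, 0 < e & forall k, (k <= n)%N ->
    e <= g * (K - k)%:R - \sum_(j | (m j <= n - k)%N) b' j.
  apply: min_pos_finite => k kn; rewrite subr_gt0.
  have := in_cond (S := <<take (K - k) s>>%VS).
  rewrite dim_flag ?leq_subr // subn_gt0 ltnS => /(_ kn).
  apply: le_lt_trans; rewrite le_eqVlt; apply/orP; left; apply/eqP.
  by apply: eq_bigl => j; rewrite hm ?leq_subr // subSn.
have [eps eps0 [he3 he4]] : exists2 e, 0 < e & e <= e1 /\ e <= e2.
  by exists (Num.min e1 e2); rewrite ?lt_min ?e1_gt0 // !ge_min !lexx orbT.
have levM j : ~~ (mxrange (M j) <= <<take (m j) s>>)%VS /\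
    (mxrange (M j) <= <<take (m j).+1 s>>)%VS.
  by rewrite !hm ?ltnn ?ltnSn // ltnW.
have [C hC] := fin_all_exists (fun j => log_minorized_trace hs s_in
  (M_in j) (ltn_ord (m j)) (levM j).1 (levM j).2 (f_min j)).
have [CD hCD] := flag_det_ub X hs.
have [CE hCE] := flag_eigenvalue_bounds hs s_in.
pose W Q := Num.max (log_flag s Q n) 0 + Num.max (- log_flag s Q 0) 0.
(* This is [ln (\det Sigma)] plus the sum of the [w_i]; [hCD] bounds it below by [- CD]. *)
pose D Q := \sum_(0 <= i < K) log_flag s Q i - ln (\det Q).
(* For [n = 0] the sign of [g] is unknown but [D] is bounded. *)
have [d [d0 [Cg hd]]] : exists d, 0 < d /\ exists Cg, forall Q,
    flag_form X s Q -> d * D Q - Cg <= g / 2 * D Q.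
  have [n0|n_gt0] := posnP n.
    have [C1 hC1] := flag_det_lb1 X hs n0.
    exists 1; split => //; exists (`|1 - g / 2| * (`|C1| + `|CD|)) => Q hQ.
    have DQ : `|D Q| <= `|C1| + `|CD|.
      rewrite ler_norml /D; have := hC1 Q hQ; have := hCD Q hQ.
      have := ler_norm C1; have := ler_norm CD.
      have := normr_ge0 C1; have := normr_ge0 CD; lra.
    have := ler_wpM2l (normr_ge0 (1 - g / 2)) DQ; rewrite -normrM.
    have := ler_norm ((1 - g / 2) * D Q); lra.
  have [S [S1 hS]] := generic_line (n_gt0 : (1 < K)%N) M_neq0.
  have := in_cond (S := S); rewrite S1 => /(_ isT).
  rewrite big1 => [|j]; last by rewrite (negbTE (hS j)).
  rewrite mulr1 => g0.
  by exists (g / 2); split; [lra | exists 0 => Q _; lra].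
(* In the bound for [|ln a|], [D] has weight [1] and [W] has weight [K]; the objective offers [d]
   for [D] and [eps / 2] for [W]. *)
have [eta eta0 [etad etaW]] : exists2 e, 0 < e & e <= d /\ e * K%:R <= eps / 2.
  have K0 : 0 < K%:R :> R by rewrite ltr0n.
  exists (Num.min d (eps / 2 / K%:R)); rewrite ?lt_min ?d0 ?divr_gt0 //.
  by rewrite -ler_pdivlMr // !ge_min !lexx orbT.
pose T := `|\sum_j C j| + `|Cg| + d * `|CD| + eta * `|CE|.
have T0 : 0 <= T by rewrite !addr_ge0 ?mulr_ge0 // ltW.
have xT : 0 <= eta^-1 + T by rewrite addr_ge0 // invr_ge0 ltW.
exists (Num.bound (eta^-1 + T)) => Sigma a Spd had ea.
apply: (ler_abs_weight eta0 T0 (archi_boundP xT)) => //.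
set Q := invmx Sigma in had *.
have hQ : flag_form X s Q by split => //; exact: posdef_invmx.
have [hE1 hE2] := hCE Sigma a Spd hQ ea.
have lndet : ln (\det Sigma) = - ln (\det Q).
  by rewrite /Q det_inv lnV ?posrE ?posdef_det_gt0 // opprK.
have hw i : (i < n)%N -> log_flag s Q i <= log_flag s Q i.+1.
  exact: (log_flag_le hs s_in hQ).
have fl := @flag_linear_bound R J n (fun j => m j) b b' g eps (log_flag s Q).
move: fl => /(_ _ _ _ hw)/wrap[j|k kn|k kn|fl].
- by rewrite -ltnS.
- exact: le_trans he3 (he1 k kn).
- exact: le_trans he4 (he2 k kn).
rewrite -/(W Q) in fl.
have sumf : \sum_j (b j / 2 * Num.max (log_flag s Q (m j)) 0
    - b' j / 2 * Num.max (- log_flag s Q (m j)) 0) - \sum_j C j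
  <= \sum_j f j (\tr ((M j)^T *m Q *m M j)).
  by rewrite -sumrB; apply: ler_sum => j _; exact: hC.
have halfE : \sum_j (b j / 2 * Num.max (log_flag s Q (m j)) 0
    - b' j / 2 * Num.max (- log_flag s Q (m j)) 0) =
  (\sum_j (b j * Num.max (log_flag s Q (m j)) 0
    - b' j * Num.max (- log_flag s Q (m j)) 0)) / 2.
  by rewrite mulr_suml; apply: eq_bigr => j _; ring.
rewrite /log_objective -/Q lndet.
have D0 : 0 <= D Q + `|CD|.
  by have := hCD Q hQ; have := ler_norm CD; rewrite /D; lra.
have W1 : 0 <= Num.max (log_flag s Q n) 0 by rewrite le_max lexx orbT.
have W2 : 0 <= Num.max (- log_flag s Q 0%N) 0 by rewrite le_max lexx orbT.
have W0 : 0 <= W Q by exact: addr_ge0.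
have W3 : log_flag s Q n <= Num.max (log_flag s Q n) 0 by rewrite le_max lexx.
have W4 : - log_flag s Q 0%N <= Num.max (- log_flag s Q 0%N) 0.
  by rewrite le_max lexx.
have K1 : n%:R + 1 = K%:R :> R by exact: natr1.
have n0 : 0 <= n%:R :> R by [].
have sum_ge : K%:R * log_flag s Q 0%N <= \sum_(0 <= i < K) log_flag s Q i.
  have -> : K%:R * log_flag s Q 0%N = \sum_(0 <= i < K) log_flag s Q 0%N.
    by rewrite sumr_const_nat subn0 mulr_natl.
  apply: ler_sum_nat => i /andP[_ iK].
  by rewrite ler_ln ?posrE ?(flag_form_gt0 hs hQ) ?(flag_form_le hs s_in hQ).
(* For the upper bound, [- ln (\det Q)] is [D] minus the sum of the [w_i], which is at least
   [K w_0]; the term [n w_n] is at most [n] times its positive part. *)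
have lna : `|ln a| <= D Q + `|CD| + K%:R * W Q + `|CE|.
  have KW1 := mulr_ge0 (ler0n R K) W1.
  have KW2 := mulr_ge0 (ler0n R K) W2.
  have KW4 := ler_wpM2l (ler0n R K) W4.
  have nW3 := ler_wpM2l n0 W3.
  have nW1 := mulr_ge0 n0 W1.
  have := normr_ge0 CD; have := ler_norm CE.
  rewrite /W mulrDr ler_norml; rewrite -K1 in KW1 KW2 KW4 sum_ge *.
  by move=> c1 c2; apply/andP; split; [lra | rewrite /D; lra].
(* The determinant term splits as [g / 2 * D] minus [g / 2] times the sum of the [w_i]: [hdQ] bounds
   the first part, and [fl] absorbs the second together with the trace terms. *)
have hdQ := hd Q hQ.
have t1 := ler_wpM2l (ltW eta0) lna.
have t2 := ler_wpM2r D0 etad.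
have t3 := ler_wpM2r W0 etaW.
have t4 := ler_norm (\sum_j C j); have t5 := ler_norm Cg.
rewrite /T; rewrite /D in hdQ t1 t2 *; lra.
Qed.

(** Every [Sigma] has an adapted flag among finitely many index tuples. The bound weakens as [N]
    grows, so the maximum over all tuples works for every [Sigma]. *)
Lemma log_objective_coerciveS :
  exists N : nat, forall Sigma a, posdefmx Sigma -> eigenvalue Sigma a ->
    `|ln a| / N.+1%:R - N%:R <= log_objective M f g Sigma.
Proof.
pose I : finType := ({j : J & 'I_(p j)} + 'I_K)%type.
pose X (i : I) : 'cV[R]_K :=
  match i with
  | inl u => col (tagged u) (M (tag u))
  | inr k => delta_mx k ord0
  end.
have Xfull (S : {vspace 'cV[R]_K}) : (forall i, X i \in S) -> (fullv <= S)%VS.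
  move=> XS; apply/subvP => v _; rewrite [v]matrix_sum_delta.
  apply: memv_suml => i _; apply: memv_suml => j _; rewrite ord1.
  by apply: memvZ; exact: (XS (inr i)).
have H (t : K.-tuple I) : exists N : nat, flag_seq (map X t) ->
    forall Sigma a, posdefmx Sigma ->
    adapted X (qform (invmx Sigma)) (map X t) -> eigenvalue Sigma a ->
    `|ln a| / N.+1%:R - N%:R <= log_objective M f g Sigma.
  (* For tuples that do not form a flag the claim is vacuous and [0] is a default. *)
  have [tf|ntf] := pselect (flag_seq (map X t)); last by exists 0%N.
  have [|| N hN] := @flag_coercive I X (map X t) tf.
  - move=> m mK; have i0 : I := inr ord0.
    by exists (nth i0 t m); rewrite (nth_map i0) // size_tuple.
  - by move=> j c; exists (inl (Tagged (fun j => 'I_(p j)) c)).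
  by exists N.
have [N hN] := fin_all_exists H.
exists (\max_t N t) => Sigma a Spd ea.
have [t [tf ta]] := adapted_flag_exists (qform (invmx Sigma)) Xfull.
apply: le_trans (hN t tf Sigma a Spd ta ea).
have Nt : (N t <= \max_t N t)%N by exact: leq_bigmax.
rewrite lerB ?ler_nat // ler_wpM2l // lef_pV2 ?posrE ?ltr0n //.
by rewrite ler_nat.
Qed.

End Coercivity.

Theorem log_objective_coercive {R : realType} (K : nat) (J : finType)
    (p : J -> nat) (M : forall j, 'M[R]_(K, p j)) (f : J -> R -> R)
    (b b' : J -> R) (g : R) : (0 < K)%N -> (forall j, M j != 0) ->
  (forall j, log_minorized (f j) (b j) (b' j)) ->
  (forall S : {vspace 'cV[R]_K}, (\dim S < K)%N ->
    g * (K%:R - (\dim S)%:R) < \sum_(j | ~~ (mxrange (M j) <= S)%VS) b j) ->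
  (forall S : {vspace 'cV[R]_K}, (0 < \dim S)%N ->
    \sum_(j | (mxrange (M j) <= S)%VS) b' j < g * (\dim S)%:R) ->
  exists N : nat, forall Sigma a, posdefmx Sigma -> eigenvalue Sigma a ->
    `|ln a| / N.+1%:R - N%:R <= log_objective M f g Sigma.
Proof. by case: K M => // n M _; exact: log_objective_coerciveS. Qed.

(** Either alternative eventually produces an eigenvalue above [expR T] or below [expR (- T)], so
    [|ln a|] exceeds any threshold. *)
Lemma coercive_cvg {R : realType} (K : nat) (F : 'M[R]_K -> R) (N : nat)
    (Sigma : nat -> 'M[R]_K) : (0 < K)%N ->
  (forall S a, posdefmx S -> eigenvalue S a ->
    `|ln a| / N.+1%:R - N%:R <= F S) ->
  (forall k, posdefmx (Sigma k)) ->
  (lambda_max (Sigma k) @[k --> \oo] --> +oo%R) \/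
    (lambda_min (Sigma k) @[k --> \oo] --> (0 : R)) ->
  F (Sigma k) @[k --> \oo] --> +oo%R.
Proof.
move=> K0 hF Spd hbd; apply/cvgryPge => B.
pose T := (`|B| + N%:R) * N.+1%:R.
have big k a : eigenvalue (Sigma k) a -> T <= `|ln a| -> B <= F (Sigma k).
  move=> ea Ta; apply: le_trans (hF _ _ (Spd k) ea).
  have := ler_norm B; move: Ta; rewrite /T -ler_pdivlMr ?ltr0n //.
  by move: (`|ln a| / _) => z; lra.
case: hbd => [/cvgryPgt/(_ (expR T))|/cvgr_lt/(_ _ (expR_gt0 (- T)))].
  apply: filterS => k hk.
  have [a ea Ta] : exists2 a, eigenvalue (Sigma k) a & expR T < a.
    apply: contrapT => H; move: hk; rewrite ltNge => /negP; apply.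
    rewrite /lambda_max.
    (* The supremum of the empty set is [0], which is below [expR T] as well. *)
    have [->|ne] := eqVneq [set a | eigenvalue (Sigma k) a] set0.
      by rewrite sup0 ltW ?expR_gt0.
    apply: ge_sup; first exact/set0P.
    by move=> a /= ea; rewrite leNgt; apply/negP => Ta; apply: H; exists a.
  apply: (big k a ea); apply: le_trans (ler_norm _).
  rewrite -[T]expRK ler_ln ?posrE ?expR_gt0 ?ltW //.
  by rewrite (lt_trans (expR_gt0 T)).
apply: filterS => k hk.
have [a ea Ta] : exists2 a, eigenvalue (Sigma k) a & a < expR (- T).
  apply: contrapT => H; move: hk; rewrite ltNge => /negP; apply.
  (* The infimum of the empty set would be [0], below [expR (- T)], so here a spectrum that is
     nonempty is essential. *)
  apply: lb_le_inf.
    by have := symmetric_has_eigenvalue K0 (posdef_sym (Spd k)).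
  by move=> a /= ea; rewrite leNgt; apply/negP => Ta; apply: H; exists a.
have a0 := posdef_eigenvalue_gt0 (Spd k) ea.
apply: (big k a ea); rewrite -normrN; apply: le_trans (ler_norm _).
by rewrite lerNr -[leRHS]expRK ler_ln ?posrE ?expR_gt0 ?ltW.
Qed.

(** * The extended-real conditions *)

Section ExtendedConditions.
Context {R : realType}.

Lemma sume_const (I : finType) (P : pred I) (a : \bar R) :
  (\sum_(i | P i) a = a * #|P|%:R%:E)%E.
Proof. by rewrite muleC mule_natl sumr_const. Qed.

(** Clears the denominator of the first quotient in (ii). For [r = +oo] the quotient is [0], so
    [P < 1] and the product on the right is [+oo]; the case of both [r] and [s] infinite is excluded
    by [dive_def]. *)
Lemma tail_quotient_bound (c P m : R) (r s : \bar R) : 0 < m ->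
  (0 <= r)%E -> (0 <= s)%E -> dive_def (c%:E - s) (r * m%:E) ->
  (P%:E < 1 - (c%:E - s) / (r * m%:E))%E ->
  (c%:E < r * (m * (1 - P))%:E + s)%E.
Proof.
move=> m0; case: r => [r||] //; case: s => [s||] //; rewrite ?lee_fin /dive_def.
- move=> r0 s0 /andP[_]; rewrite -EFinM inver.
  have [rm|rm] := eqVneq (r * m) 0.
    (* The quotient is then infinite with the sign of [c - s]; [+oo] would contradict the
       inequality, so [c < s]. *)
    have {}r0 : r = 0 by apply: (mulIf (lt0r_neq0 m0)); rewrite rm mul0r.
    rewrite r0 mul0e add0e lte_fin -EFinB /= => cs.
    have [cs_lt0|cs_gt0|/eqP] := ltgtP (c - s) 0.
    - by move=> _; lra.
    - by rewrite gt0_muley ?lte_fin.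
    - by rewrite (negbTE cs).
  have r_gt0 : 0 < r * m by rewrite lt_neqAle eq_sym rm mulr_ge0 // ltW.
  move=> _; rewrite (_ : (1 - (c%:E - s%:E) * ((r * m)^-1)%:E =
    (1 - (c - s) * (r * m)^-1)%:E)%E) // -EFinM -EFinD !lte_fin.
  rewrite ltrBrDl -ltrBrDr ltr_pdivrMr //; lra.
- by move=> _ _ _ _; rewrite -EFinM /= ltry.
- move=> _ _ _; rewrite (@gt0_mulye _ m%:E) ?lte_fin // mulr0 subr0 => P1.
  by rewrite gt0_mulye ?lte_fin ?mulr_gt0 ?subr_gt0 // ltry.
- by move=> _ _; rewrite gt0_mulye ?lte_fin // invey /= eqxx andbF.
Qed.

(** Clears the second denominator; [dive_def] forces it to be nonnegative, which rules out
    [r = -oo]. The result is negated into a lower bound, the shape that [real_minorants] accepts. *)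
Lemma origin_quotient_bound (c P m : R) (r s : \bar R) : 0 < m -> 0 <= P ->
  (r < +oo)%E -> (s < +oo)%E -> dive_def (c%:E - s) (r * m%:E) ->
  (P%:E < (c%:E - s) / (r * m%:E))%E ->
  ((- c)%:E < - r * (m * P)%:E - s)%E.
Proof.
move=> m0 P0; case: r => [r||] //; case: s => [s||] // _ _; rewrite /dive_def.
- move=> /andP[]; rewrite -EFinM inver lee_fin => rm0.
  have [rm|rm] := eqVneq (r * m) 0.
    have {}r0 : r = 0 by apply: (mulIf (lt0r_neq0 m0)); rewrite rm mul0r.
    rewrite r0 oppe0 mul0e add0e -EFinN lte_fin -EFinB /= => cs.
    have [cs_lt0|cs_gt0|/eqP] := ltgtP (c - s) 0.
    - by rewrite lt0_muley ?lte_fin.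
    - by move=> _; lra.
    - by rewrite (negbTE cs).
  have r_gt0 : 0 < r * m by rewrite lt_neqAle eq_sym rm.
  move=> _; rewrite -EFinB -EFinM -EFinN -EFinM -EFinB !lte_fin.
  rewrite ltr_pdivlMr //; lra.
- by move=> _ _; rewrite -EFinN -EFinM /= ltry.
- by rewrite gt0_mulNye ?lte_fin.
- by rewrite gt0_mulNye ?lte_fin.
Qed.

Lemma tail_sum_bound (c m : R) (r s : \bar R) : (0 <= r)%E -> (0 <= s)%E ->
  0 < m -> (0 < r / 2%:E * m%:E - (c / 2)%:E + (2^-1)%:E * s)%E ->
  (c%:E < r * m%:E + s)%E.
Proof.
move=> r0 s0 m0; move: r0 s0; case: r => [r||] //; case: s => [s||] //.
- move=> _ _; rewrite inver pnatr_eq0 /= -?EFinM -?EFinN -?EFinD ?lte_fin; lra.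
- by move=> _ _ _; rewrite -EFinM /= ltry.
- by move=> _ _ _; rewrite gt0_mulye ?lte_fin // ltry.
- by move=> _ _ _; rewrite gt0_mulye ?lte_fin // ltry.
Qed.

(** Opposite infinities add up to [-oo] by convention; once [r +? s] excludes them, a negative total
    leaves no room for [+oo]. *)
Lemma origin_sum_bound (c m : R) (r s : \bar R) : 0 < m -> (r +? s)%E ->
  ((- (c / 2))%:E + r / 2%:E * m%:E + (2^-1)%:E * s < 0)%E ->
  [/\ (r < +oo)%E, (s < +oo)%E & ((- c)%:E < - r * m%:E - s)%E].
Proof.
move=> m0; have h0 : 0 < 2^-1 :> R by rewrite invr_gt0.
rewrite inver pnatr_eq0 /=.
case: r => [r||] //; case: s => [s||] // _;
  rewrite ?(gt0_muley, gt0_mulye, gt0_muleNy, gt0_mulNye) ?lte_fin //.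
- by move=> h; split; rewrite ?ltry //; lra.
- by move=> _; split; rewrite ?ltry // -EFinN -EFinM /= ltry.
- by move=> _; split; rewrite ?ltry //= gt0_mulye ?lte_fin //= ltry.
- by move=> _; split; rewrite ?ltry //= gt0_mulye ?lte_fin //= ltry.
Qed.

Lemma sume_lty (I : finType) (a : I -> \bar R) : sume_def a ->
  (\sum_i a i < +oo)%E -> forall i, (a i < +oo)%E.
Proof.
move=> ad s i; rewrite ltey; apply/eqP => ai; move: s.
suff -> : (\sum_i a i = +oo)%E by [].
rewrite (bigD1 i) //= ai addye //.
elim/big_ind: _ => // [u v|j _].
  by rewrite adde_eq_ninfty negb_or => -> ->.
by have := ad i j; rewrite ai; case: (a j).
Qed.

End ExtendedConditions.

(** * Reduction to the uniform coercivity bound *)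

Theorem theorem3 (R : realType) (K N L : nat)
  (x : 'I_N -> 'cV[R]_K)
  (alpha : R) (alphas : 'I_L -> R)
  (p : 'I_L -> nat) (A : forall l : 'I_L, 'M[R]_(K, p l))
  (rho : R -> R) (h : 'I_L -> R -> R)
  (a_rho a'_rho : \bar R) (a a' : 'I_L -> \bar R)
  (N_gt0 : (0 < N)%N)
  (A_neq0 : forall l, A l != 0)
  (rho_cont : {in `]0, +oo[, continuous rho})
  (h_cont : forall l, {in `]0, +oo[, continuous (h l)})
  (a_rhoE : a_rho = tail_exponent rho)
  (a'_rhoE : a'_rho = origin_exponent rho)
  (aE : forall l, a l = tail_exponent (fun s => alphas l * h l s))
  (a'E : forall l, a' l = origin_exponent (fun s => alphas l * h l s))
  (a_rho_ge0 : (0 <= a_rho)%E)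
  (a_ge0 : forall l, (0 <= a l)%E)
  (x_neq0 : forall i, x i != 0)
  (sub_cond : forall S : {vspace 'cV[R]_K}, proper_subspace S ->
    let num1 := (((N%:R + 2 * alpha) * (K%:R - (\dim S)%:R))%:E
                 - \sum_(l < L | ~~ (mxrange (A l) <= S)%VS) a l)%E in
    let den1 := (a_rho * N%:R%:E)%E in
    let num2 := (((N%:R + 2 * alpha) * (\dim S)%:R)%:E
                 - \sum_(l < L | (mxrange (A l) <= S)%VS) a' l)%E in
    let den2 := (a'_rho * N%:R%:E)%E in
    [/\ dive_def num1 den1, dive_def num2 den2 &
        ((sample_prop x S)%:E < Order.min (1 - num1 / den1) (num2 / den2))%E])
  (sum_def : sume_def a' /\ (a'_rho +? \sum_(l < L) a' l)%E)
  (origin_cond :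
    (((- (N%:R / 2) - alpha) * K%:R)%:E + a'_rho / 2%:E * N%:R%:E
     + (2^-1)%:E * \sum_(l < L) a' l < 0)%E)
  (tail_cond :
    (0 < a_rho / 2%:E * N%:R%:E - ((N%:R / 2 + alpha) * K%:R)%:E
         + (2^-1)%:E * \sum_(l < L) a l)%E)
  (Sigma : nat -> 'M[R]_K)
  (Sigma_pd : forall k, posdefmx (Sigma k))
  (Sigma_bd : (lambda_max (Sigma k) @[k --> \oo] --> +oo%R) \/
              (lambda_min (Sigma k) @[k --> \oo] --> (0 : R))) :
  Ltilde x A alpha alphas rho h (Sigma k) @[k --> \oo] --> +oo%R.
Proof.
have K_gt0 : (0 < K)%N.
  rewrite lt0n; apply/eqP => K0; have := x_neq0 (Ordinal N_gt0).
  by move/eqP; apply; apply/colP => i; have := ltn_ord i;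
    rewrite [X in (_ < X)%N]K0.
pose g : R := N%:R + 2 * alpha.
have N0 : 0 < N%:R :> R by rewrite ltr0n.
have suma_ge0 P : (0 <= \sum_(l < L | P l) a l)%E by exact: sume_ge0.
have [a'_def a'_rho_def] := sum_def.
(* [origin_cond] is the in-subspace condition for the whole space, which is not proper. *)
have [a'_rho_lty suma'_lty full_cond] :
    [/\ (a'_rho < +oo)%E, (\sum_(l < L) a' l < +oo)%E &
      ((- (g * K%:R))%:E < - a'_rho * N%:R%:E - \sum_(l < L) a' l)%E].
  apply: origin_sum_bound => //; move: origin_cond.
  by rewrite /g (_ : (- (N%:R / 2) - alpha) * K%:R =
    - ((N%:R + 2 * alpha) * K%:R / 2)) //; lra.
have a'_lty := sume_lty a'_def suma'_lty.
(* [tail_cond] is the out-of-subspace condition for the zero subspace, which contains no [x i] and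
   no range. *)
have zero_cond : ((g * K%:R)%:E < a_rho * N%:R%:E + \sum_(l < L) a l)%E.
  apply: tail_sum_bound => //.
  move: tail_cond; rewrite /g (_ : (N%:R / 2 + alpha) * K%:R =
    (N%:R + 2 * alpha) * K%:R / 2) //; lra.
pose J : finType := ('I_N + 'I_L)%type.
pose pJ (j : J) := match j with inl _ => 1%N | inr l => p l end.
pose M (j : J) : 'M[R]_(K, pJ j) :=
  match j with inl i => x i | inr l => A l end.
pose f (j : J) : R -> R :=
  match j with inl _ => rho | inr l => fun s => alphas l * h l s end.
pose aJ (j : J) := match j with inl _ => a_rho | inr l => a l end.
(* The sign turns infima, approached from above, into quantities approached from below, so
   [real_minorants] serves both families. *)
pose aJ' (j : J) := (- match j with inl _ => a'_rho | inr l => a' l end)%E.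
have M_neq0 j : M j != 0 by case: j.
have f_cont j : {in `]0, +oo[, continuous (f j)}.
  case: j => [i|l] //= s s0; apply: cvgM; first exact: cvg_cst.
  exact: h_cont.
have aJ_E j : aJ j = tail_exponent (f j) by case: j.
have aJ'_E j : aJ' j = (- origin_exponent (f j))%E.
  by case: j => [i|l]; rewrite /aJ' ?a'_rhoE ?a'E.
have aJ_gt j : (-oo < aJ j)%E.
  by apply: (@lt_le_trans _ _ 0%E); [exact: ltNy0 | case: j].
have aJ'_gt j : (-oo < aJ' j)%E by rewrite ltNye eqe_oppLR -ltey; case: j.
have x_range i (S : {vspace 'cV[R]_K}) :
    (mxrange (x i) <= S)%VS = (x i \in S).
  apply/mxrange_subvP/idP => [/(_ ord0)|xS c].
    by rewrite (_ : col _ _ = x i) //; apply/colP => k; rewrite !mxE.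
  by rewrite (_ : col _ _ = x i) //; apply/colP => k; rewrite !mxE ord1.
have in_prop (S : {vspace 'cV[R]_K}) :
    N%:R * sample_prop x S = #|[pred i | x i \in S]|%:R.
  rewrite /sample_prop mulVKf ?gt_eqF // -sum1_card natr_sum [RHS]big_mkcond /=.
  by apply: eq_bigr => i _; rewrite inE; case: (x i \in S).
have out_prop (S : {vspace 'cV[R]_K}) :
    N%:R * (1 - sample_prop x S) = #|[pred i | x i \notin S]|%:R.
  rewrite mulrBr mulr1 in_prop -{1}[N]card_ord.
  by rewrite -(cardC [pred i | x i \in S]) natrD addrC addKr.
have sum_out (S : {vspace 'cV[R]_K}) :
    (\sum_(j | ~~ (mxrange (M j) <= S)%VS) aJ j =
    a_rho * (N%:R * (1 - sample_prop x S))%:E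
    + \sum_(l < L | ~~ (mxrange (A l) <= S)%VS) a l)%E.
  rewrite big_sumType /= out_prop -sume_const.
  by congr (_ + _)%E; apply: eq_bigl => i; rewrite x_range.
have sum_in (S : {vspace 'cV[R]_K}) :
    (\sum_(j | (mxrange (M j) <= S)%VS) aJ' j =
    - a'_rho * (N%:R * sample_prop x S)%:E
    - \sum_(l < L | (mxrange (A l) <= S)%VS) a' l)%E.
  rewrite big_sumType /= in_prop -sume_const; congr (_ + _)%E.
    by apply: eq_bigl => i; rewrite x_range.
  by rewrite -sumeN.
have out_cond (S : {vspace 'cV[R]_K}) : (\dim S < K)%N ->
    ((g * (K%:R - (\dim S)%:R))%:E <
     \sum_(j | ~~ (mxrange (M j) <= S)%VS) aJ j)%E.
  rewrite sum_out => dS; have [S0|S_gt0] := posnP (\dim S).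
    have {}S0 : S = 0%VS by apply/eqP; rewrite -dimv_eq0 S0.
    rewrite S0 dimv0 subr0 out_prop.
    rewrite (eq_card (B := predT)); last first.
      by move=> i; rewrite !inE memv0 x_neq0.
    rewrite card_ord (eq_bigl xpredT) // => l.
    by rewrite mxrange_sub0 A_neq0.
  have [|d1 _ hS] := sub_cond S.
    by rewrite /proper_subspace S_gt0 -ltnS prednK.
  apply: tail_quotient_bound d1 _ => //.
  by apply: lt_le_trans hS _; rewrite ge_min lexx.
have in_cond (S : {vspace 'cV[R]_K}) : (0 < \dim S)%N ->
    ((- (g * (\dim S)%:R))%:E <
     \sum_(j | (mxrange (M j) <= S)%VS) aJ' j)%E.
  rewrite sum_in => dS; have [SK|S_ltK] := leqP K (\dim S).
    have SE : S = fullv by apply/eqP; rewrite eqEdim subvf dim_cV.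
    rewrite SE dim_cV in_prop (eq_card (B := predT)); last first.
      by move=> i; rewrite !inE memvf.
    by rewrite card_ord (eq_bigl xpredT) // => l; rewrite subvf.
  have [|_ d2 hS] := sub_cond S.
    by rewrite /proper_subspace dS -ltnS prednK.
  have P0 : 0 <= sample_prop x S.
    by rewrite -(pmulr_rge0 _ N0) in_prop.
  apply: origin_quotient_bound d2 _ => //.
    by apply: lte_sum_pinfty => l _.
  by apply: lt_le_trans hS _; rewrite ge_min lexx orbT.
(* The bounds depend on [S] only through its dimension, hence are finitely many: dimensions below
   [K] here, and up to [K] for [b']. *)
have [b [b_lt hb]] := real_minorants (fun d : 'I_K => g * (K%:R - d%:R)) aJ_gt.
have [b' [b'_lt hb']] :=
  real_minorants (fun d : 'I_K.+1 => - (g * d%:R)) aJ'_gt.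
have f_min j : log_minorized (f j) (b j) (- b' j).
  apply: exponents_log_minorized => //; first by rewrite -aJ_E.
  by rewrite EFinN lteNr -aJ'_E.
have out_condR (S : {vspace 'cV[R]_K}) : (\dim S < K)%N ->
    g * (K%:R - (\dim S)%:R) < \sum_(j | ~~ (mxrange (M j) <= S)%VS) b j.
  move=> dS.
  pose T := finset (fun j => ~~ (mxrange (M j) <= S)%VS).
  have TE j : (j \in T) = ~~ (mxrange (M j) <= S)%VS by rewrite inE.
  have := hb T (Ordinal dS); rewrite !(eq_bigl _ _ TE).
  by move=> /(_ (out_cond S dS)).
have in_condR (S : {vspace 'cV[R]_K}) : (0 < \dim S)%N ->
    \sum_(j | (mxrange (M j) <= S)%VS) - b' j < g * (\dim S)%:R.
  move=> dS; have dK : (\dim S < K.+1)%N.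
    by rewrite ltnS -[X in (_ <= X)%N](@dim_cV R) dimvS ?subvf.
  pose T := finset (fun j => (mxrange (M j) <= S)%VS).
  have TE j : (j \in T) = (mxrange (M j) <= S)%VS by rewrite inE.
  have := hb' T (Ordinal dK); rewrite !(eq_bigl _ _ TE).
  by move=> /(_ (in_cond S dS)); rewrite sumrN ltrNl.
have [n hn] := log_objective_coercive K_gt0 M_neq0 f_min out_condR in_condR.
have LE S : Ltilde x A alpha alphas rho h S = log_objective M f g S.
  rewrite /Ltilde /log_objective big_sumType /= /g.
  have -> : \sum_(i < N) rho (\tr ((x i)^T *m invmx S *m x i)) =
      \sum_(i < N) rho (((x i)^T *m invmx S *m x i) ord0 ord0).
    by apply: eq_bigr => i _; rewrite /mxtrace big_ord1.
  lra.
under eq_cvg do rewrite LE.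
exact: coercive_cvg K_gt0 hn Sigma_pd Sigma_bd.
Qed.
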